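(* Let $m,n$ be non-zero integers with $0<m\leq |n|$ and let $G=\mathrm{BS}(m,n)=\langle a,t\mid t^{-1}a^{m}t=a^{n}\rangle$. Then $[\gamma_{\omega}(G),G]=\gamma_{\omega}(G)$.
   Context: For a group $G$, $[x,y]=x^{-1}y^{-1}xy$, and for subgroups $A,B$ of $G$, $[A,B]$ is the subgroup generated by all $[a,b]$ with $a\in A$, $b\in B$. $\gamma_1(G)=G$, $\gamma_{c}(G)=[\gamma_{c-1}(G),G]$ for $c\ge 2$ are the terms of the lower central series, and $\gamma_{\omega}(G)=\bigcap_{c\geq 1}\gamma_c(G)$. *)

(* Defs.v *)
From HB Require Import structures.
From mathcomp Require Import all_boot all_order all_algebra.
From mathcomp Require Import generic_quotient boolp classical_sets.

Set Implicit Arguments.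
Unset Strict Implicit.
Unset Printing Implicit Defensive.

Import Order.TTheory GRing.Theory Num.Theory.

Local Open Scope classical_set_scope.
Local Open Scope ring_scope.
Local Open Scope group_scope.
Local Open Scope quotient_scope.

Section CommutatorSubgroups.
Variable G : groupType.
Implicit Types (A B : set G) (c : nat).

Definition gen_subgroup A : set G :=
  smallest [set H : set G | group_closed [in H]] A.

Definition comm_subgroup A B : set G :=
  gen_subgroup [set z | exists2 x, A x & exists2 y, B y & z = [~ x, y]].

(* [lcs c] is the c-th term of the lower central series, numbered from 1;
   [lcs 0] is also the whole group. *)
Definition lcs c : set G :=
  iter c.-1 (fun H => comm_subgroup H [set: G]) [set: G].

Definition lcs_omega : set G := \bigcap_(c in [set c | (1 <= c)%N]) lcs c.

End CommutatorSubgroups.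

Arguments lcs G c : clear implicits.
Arguments lcs_omega G : clear implicits.

(* Groups given by generators and relations, as quotients of the monoid of
   words. The letter (x, false) stands for the generator x and (x, true) for
   its inverse; R u v is the defining relation u = v. *)
Section Presentation.
Variables (X : choiceType) (R : seq (X * bool) -> seq (X * bool) -> Prop).

Inductive pres_eq : seq (X * bool) -> seq (X * bool) -> Prop :=
| pres_rel u v : R u v -> pres_eq u v
| pres_cancel x b : pres_eq [:: (x, b); (x, ~~ b)] [::]
| pres_cat u u' v v' : pres_eq u u' -> pres_eq v v' ->
    pres_eq (u ++ v) (u' ++ v')
| pres_refl u : pres_eq u u
| pres_sym u v : pres_eq u v -> pres_eq v u
| pres_trans v u w : pres_eq u v -> pres_eq v w -> pres_eq u w.

Definition pres_eqb u v : bool := `[< pres_eq u v >].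

Fact pres_eqb_refl : reflexive pres_eqb.
Proof. by move=> u; apply/asboolP/pres_refl. Qed.

Fact pres_eqb_sym : symmetric pres_eqb.
Proof. by move=> u v; apply/asboolP/asboolP => /pres_sym. Qed.

Fact pres_eqb_trans : transitive pres_eqb.
Proof.
by move=> v u w /asboolP uv /asboolP vw; apply/asboolP/(pres_trans uv vw).
Qed.

Canonical pres_equiv := EquivRel pres_eqb
  pres_eqb_refl pres_eqb_sym pres_eqb_trans.

Definition presented : Type := {eq_quot pres_equiv}.

HB.instance Definition _ := Choice.on presented.

Definition pres_class u : presented := (\pi_({eq_quot pres_equiv}) u).
Definition pres_word (x : presented) : seq (X * bool) :=
  repr (x : {eq_quot pres_equiv}).

Lemma pres_wordK x : pres_class (pres_word x) = x.
Proof. exact: reprK. Qed.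

Lemma pres_classP u v : pres_class u = pres_class v <-> pres_eq u v.
Proof.
by split=> [/eqmodP/asboolP | uv]; last by apply/eqmodP/asboolP.
Qed.

Lemma pres_classK u : pres_eq (pres_word (pres_class u)) u.
Proof. by apply/pres_classP; rewrite pres_wordK. Qed.

Definition word_inv (u : seq (X * bool)) : seq (X * bool) :=
  rev [seq (l.1, ~~ l.2) | l <- u].

Definition pres_one : presented := pres_class [::].
Definition pres_mul (x y : presented) : presented :=
  pres_class (pres_word x ++ pres_word y).
Definition pres_inv (x : presented) : presented :=
  pres_class (word_inv (pres_word x)).

Lemma pres_mulA : associative pres_mul.
Proof.
move=> x y z; apply/pres_classP.
apply: (@pres_trans (pres_word x ++ pres_word y ++ pres_word z)).
  by apply: pres_cat; [exact: pres_refl | exact: pres_classK].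
rewrite catA; apply: pres_cat; last exact: pres_refl.
by apply: pres_sym; exact: pres_classK.
Qed.

Lemma pres_mul1 : left_id pres_one pres_mul.
Proof.
move=> x; rewrite -[RHS]pres_wordK; apply/pres_classP.
by apply: (pres_cat (pres_classK [::])); exact: pres_refl.
Qed.

Lemma pres_mulr1 : right_id pres_one pres_mul.
Proof.
move=> x; rewrite -[RHS]pres_wordK -[in RHS](cats0 (pres_word x)).
apply/pres_classP.
by apply: pres_cat; [exact: pres_refl | exact: pres_classK].
Qed.

Lemma word_invV u : pres_eq (word_inv u ++ u) [::].
Proof.
rewrite /word_inv; elim: u => [|[x b] u IHu]; first exact: pres_refl.
rewrite map_cons rev_cons cat_rcons; set w := rev _ in IHu *.
apply: (pres_trans _ IHu); apply: pres_cat; first exact: pres_refl.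
apply: (@pres_cat [:: (x, ~~ b); (x, b)] [::] u u); last exact: pres_refl.
by rewrite -[in (x, b)](negbK b); exact: pres_cancel.
Qed.

Lemma word_invK : involutive word_inv.
Proof.
move=> u; rewrite /word_inv map_rev revK -map_comp -[RHS]map_id.
by apply: eq_map => -[x b] /=; rewrite negbK.
Qed.

Lemma pres_mulV : left_inverse pres_one pres_inv pres_mul.
Proof.
move=> x; apply/pres_classP; apply: (pres_trans _ (word_invV (pres_word x))).
by apply: pres_cat; [exact: pres_classK | exact: pres_refl].
Qed.

Lemma pres_mulrV : right_inverse pres_one pres_inv pres_mul.
Proof.
move=> x; apply/pres_classP.
apply: (pres_trans _ (word_invV (word_inv (pres_word x)))).
rewrite word_invK.
by apply: pres_cat; [exact: pres_refl | exact: pres_classK].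
Qed.

HB.instance Definition _ := isGroup.Build presented
  pres_mulA pres_mul1 pres_mulr1 pres_mulV pres_mulrV.

End Presentation.

Variant bs_gen := bs_a | bs_t.

Definition bool_of_bs_gen x := if x is bs_t then true else false.
Definition bs_gen_of_bool b := if b then bs_t else bs_a.

Fact bool_of_bs_genK : cancel bool_of_bs_gen bs_gen_of_bool.
Proof. by case. Qed.

HB.instance Definition _ := Countable.copy bs_gen (can_type bool_of_bs_genK).

Definition gen_pow (X : Type) (x : X) (k : int) : seq (X * bool) :=
  nseq `|k|%N (x, (k < 0)%R).

Definition bs_rel (m n : int) (u v : seq (bs_gen * bool)) : Prop :=
  u = gen_pow bs_t (- 1)%R ++ gen_pow bs_a m ++ gen_pow bs_t 1%R
  /\ v = gen_pow bs_a n.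

Definition BS (m n : int) : groupType := Group.clone (presented (bs_rel m n)) _.

(* Main.v *)
Require Import Defs.
From HB Require Import structures.
From mathcomp Require Import all_boot all_order all_algebra.
From mathcomp Require Import generic_quotient boolp classical_sets ring zify.

Set Implicit Arguments.
Unset Strict Implicit.
Unset Printing Implicit Defensive.

Import Order.TTheory GRing.Theory Num.Theory.

(** Let d be the gcd of the two exponents, so that G = BS(d m, d n) with
    m r + n s = 1 for some r, s; put b = a^d, W = gamma_omega(G), V = [W, G]
    and write x^y for y^-1 x y. Only W <= V needs an argument.

    Some elements of G lie in every term of the lower central series, the
    residual relators: the commutators [a, b^(t^i)], the commutators of the
    t-conjugates of a^e and a^e' when d = e e' with e, e' coprime, and b itself
    when |n - m| = 1. The reason is one self-improving statement
    (residual_relator_comm): if a set U contains them, so does [U, G]. Indeed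
    the images of U are central in G / [U, G], and there the commutator
    identities force a central relator to be trivial. For [a, b^(t^i)] this
    uses that the t-conjugates of b generate an abelian group isomorphic to a
    quotient of Z[1/mn], with t acting as n/m: x |-> [a, x] is a homomorphism
    of exponent dividing d that kills b, and infinite divisibility by m and n
    makes it trivial. Taking U = gamma_c in turn, and then U = W, shows that
    the relators lie in V (residual_relator_omega).

    It remains to see that the group Q = G / V, in which the relators hold, has
    no non-trivial element in the image of W; this comes from two families of
    representations of G in groups of triangular matrices with a filtration
    that forces W to act trivially (rep_omega).
    - For a prime p, write d = p^k c with p not dividing c. Modulo the
      t-conjugates of b, the subgroup generated by t and a^c is the free product
      of an infinite cyclic group and a cyclic group of order p^k, and its
      non-trivial elements are detected by unipotent matrices over F_p, as in
      Magnus' proof for free groups (magnus_detect, word_detect). By the coprime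
      relators the prime parts of a commute, so the primes can be treated one
      at a time, and W maps into the group generated by the t-conjugates of b
      (unipotently_trivialP).
    - That group is trivial if |n - m| = 1. Otherwise each of its elements is
      conjugate to a power of an m^k-th root of b for some k, and is detected by
      letting a act as x |-> x + 1 and t as the multiplication by n/m on a ring
      where n - m is nilpotent (affine_rep, affinely_trivialP). *)

Local Open Scope quotient_scope.
Local Open Scope classical_set_scope.
Local Open Scope ring_scope.
Local Open Scope group_scope.

(** * Generated subgroups, integer powers and central quotients *)

Lemma conjgEr (G : groupType) (x y : G) : x ^ y = y^-1 * x * y.
Proof. by rewrite conjgE mulgA. Qed.

Lemma commgE4 (G : groupType) (x y : G) : [~ x, y] = x^-1 * y^-1 * x * y.
Proof. by rewrite commgEl conjgEr !mulgA. Qed.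

Section GeneratedSubgroup.
Variable G : groupType.
Implicit Types (A : set G) (x y : G).

Lemma gen_subgroupP A x :
  gen_subgroup A x <->
  forall H : set G, H 1 -> (forall u v, H u -> H v -> H (u / v)) ->
    A `<=` H -> H x.
Proof.
split=> [Ax H H1 HV AH | Ax H [[H1 HV] AH]].
  apply: Ax; split=> //; split; first by rewrite inE.
  by move=> u v; rewrite !inE; exact: HV.
apply: Ax => // [|u v Hu Hv]; first by move: H1; rewrite inE.
by have := HV u v; rewrite !inE; exact.
Qed.

Lemma gen_sub A : A `<=` gen_subgroup A.
Proof. by move=> x Ax H [_]; apply. Qed.

Lemma gen1 A : gen_subgroup A 1.
Proof. by apply/gen_subgroupP. Qed.

Lemma gen_div A x y :
  gen_subgroup A x -> gen_subgroup A y -> gen_subgroup A (x / y).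
Proof.
move=> /gen_subgroupP Ax /gen_subgroupP Ay; apply/gen_subgroupP => H H1 HV AH.
by apply: (HV); [exact: Ax | exact: Ay].
Qed.

Lemma genV A x : gen_subgroup A x -> gen_subgroup A x^-1.
Proof. by rewrite -[x^-1]mul1g; apply: gen_div; exact: gen1. Qed.

Lemma genM A x y :
  gen_subgroup A x -> gen_subgroup A y -> gen_subgroup A (x * y).
Proof. by move=> Ax /genV Ay; rewrite -[y]invgK; exact: gen_div. Qed.

Lemma gen_ind A (P : G -> Prop) :
  P 1 -> (forall g x, P g -> A x -> P (g * x)) ->
  (forall g x, P g -> A x -> P (g / x)) ->
  forall g, gen_subgroup A g -> P g.
Proof.
move=> P1 PM PV g /gen_subgroupP Ag.
pose H := [set g | (forall h, P h -> P (h * g)) /\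
                  (forall h, P h -> P (h / g))].
suff [+ _] : H g by move=> /(_ 1 P1); rewrite mul1g.
apply: Ag => [|u v [uM uV] [vM vV]|x Ax].
- by split=> h; rewrite ?divg1 ?mulg1.
- split=> h Ph; first by rewrite mulgA; apply/vV/uM.
  by rewrite invgM invgK mulgA; apply/uV/vM.
by split=> h Ph; [exact: PM|exact: PV].
Qed.

Lemma gen_subgroup_min A (H : set G) :
  H 1 -> (forall u v, H u -> H v -> H (u / v)) -> A `<=` H ->
  gen_subgroup A `<=` H.
Proof. by move=> H1 HV AH x /gen_subgroupP; apply. Qed.

End GeneratedSubgroup.

Lemma gen_ind_l (G : groupType) (A : set G) (P : G -> Prop) :
  P 1 -> (forall g x, P g -> A x -> P (x * g)) ->
  (forall g x, P g -> A x -> P (x^-1 * g)) ->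
  forall g, gen_subgroup A g -> P g.
Proof.
move=> P1 PM PV g Ag.
suff: forall h, P h -> P (g * h) by move=> /(_ 1 P1); rewrite mulg1.
elim/gen_ind: Ag => [|u x IH Ax|u x IH Ax] h Ph; first by rewrite mul1g.
  by rewrite -mulgA; apply/IH/PM.
by rewrite -mulgA; apply/IH/PV.
Qed.

Lemma gen_subset (G : groupType) (A B : set G) :
  A `<=` gen_subgroup B -> gen_subgroup A `<=` gen_subgroup B.
Proof. by apply: gen_subgroup_min; [exact: gen1 | exact: gen_div]. Qed.

Definition zpow (G : groupType) (x : G) (k : int) : G :=
  match k with Posz n => x ^+ n | Negz n => x ^- n.+1 end.

Notation "x ^z k" := (zpow x k) (at level 29, left associativity) : group_scope.

Section IntegerPowers.
Variable G : groupType.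
Implicit Types (x y z : G) (i j k : int).

Lemma zpow0 x : x ^z 0 = 1. Proof. by []. Qed.
Lemma zpow1 x : x ^z 1 = x. Proof. by []. Qed.

Lemma zpowS x k : x ^z (k + 1)%R = x ^z k * x.
Proof.
case: k => n; first by rewrite addrC -intS /= expgSr.
have -> : (Negz n + 1)%R = - n%:Z by rewrite NegzE intS; ring.
case: n => [|n] /=; first by rewrite mulVg.
by rewrite [x ^+ n.+2]expgS invgM mulgVK.
Qed.

Lemma zpowP x k : x ^z (k - 1)%R = x ^z k / x.
Proof. by rewrite -[in RHS](subrK 1%R k) zpowS mulgK. Qed.

Lemma int_step_ind (P : int -> Prop) :
  P 0%R -> (forall k, P k -> P (k + 1)%R) ->
  (forall k, P k -> P (k - 1)%R) -> forall k, P k.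
Proof.
move=> P0 PS PP; elim/int_rect => [//|n /PS|n /PP].
  by rewrite addrC -intS.
by rewrite -opprD addrC -intS.
Qed.

Lemma zpowD x i j : x ^z (i + j)%R = x ^z i * x ^z j.
Proof.
elim/int_step_ind: j => [|j IH|j IH]; first by rewrite addr0 mulg1.
  by rewrite addrA !zpowS IH mulgA.
by rewrite addrA !zpowP IH mulgA.
Qed.

Lemma zpowN x k : x ^z (- k)%R = (x ^z k)^-1.
Proof. by apply: (mulgI (x ^z k)); rewrite -zpowD subrr mulgV. Qed.

Lemma zpow_nat x (n : nat) : x ^z n%:Z = x ^+ n. Proof. by []. Qed.

Lemma zpowM x i j : x ^z (i * j)%R = x ^z i ^z j.
Proof.
elim/int_step_ind: j => [|j IH|j IH]; first by rewrite mulr0.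
  by rewrite [RHS]zpowS mulrDr mulr1 zpowD IH.
by rewrite [RHS]zpowP mulrBr mulr1 zpowD zpowN IH.
Qed.

Lemma zpowV x k : x^-1 ^z k = (x ^z k)^-1.
Proof. by case: k => n /=; rewrite expVgn. Qed.

Lemma zpowC x i j : x ^z i ^z j = x ^z j ^z i.
Proof. by rewrite -!zpowM mulrC. Qed.

Lemma zpow_one k : 1 ^z k = 1 :> G.
Proof. by case: k => n /=; rewrite expg1n ?invg1. Qed.

Lemma commute_zpow x y k : commute x y -> commute x (y ^z k).
Proof. by move=> xy; case: k => n /=; [|apply: commuteV]; apply: commuteX. Qed.

Lemma commute_zpow2 x y i j : commute x y -> commute (x ^z i) (y ^z j).
Proof.
by move=> xy; apply/commute_zpow/commute_sym/commute_zpow/commute_sym.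
Qed.

Lemma zpowMg x y k : commute x y -> (x * y) ^z k = x ^z k * y ^z k.
Proof.
move=> xy; case: k => n /=; rewrite expgMn // invgM.
by apply: commute_sym; apply: commuteV; apply/commute_sym/commuteV/commuteX2.
Qed.

Lemma conj_zpow x y k : (x ^z k) ^ y = (x ^ y) ^z k.
Proof. by case: k => n /=; rewrite ?conjVg conjXg. Qed.

Lemma gen_zpow (A : set G) x k : gen_subgroup A x -> gen_subgroup A (x ^z k).
Proof.
move=> Ax; elim/int_step_ind: k => [|k IH|k IH]; first exact: gen1.
  by rewrite zpowS; apply: genM.
by rewrite zpowP; apply: gen_div.
Qed.

End IntegerPowers.

Section CentralQuotient.
Variables (G : groupType) (U : set G).
Implicit Types x y z : G.

Let V : set G := comm_subgroup U [set: G].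

(** [U, G] is normal for an arbitrary subset U, because
    [u, h]^y = [u, y]^-1 [u, h y]. *)
Lemma comm_subgroup_conj x y : V x -> V (x ^ y).
Proof.
have VJ u h : U u -> V ([~ u, h] ^ y).
  move=> Uu; have -> : [~ u, h] ^ y = [~ u, y]^-1 * [~ u, h * y].
    by rewrite !commgE4 !conjgEr !invgM !invgK !mulgA !(mulgK, mulgVK).
  by apply: genM; [apply: genV|]; apply: gen_sub; exists u => //; eexists.
elim/gen_ind => [|g c Vg [u Uu [h _ ->]]|g c Vg [u Uu [h _ ->]]].
- by rewrite conj1g; exact: gen1.
- by rewrite conjMg; apply: genM => //; exact: VJ.
by rewrite conjMg conjVg; apply: gen_div => //; exact: VJ.
Qed.

Definition cquot_eqb x y : bool := `[< V (x^-1 * y) >].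

Fact cquot_eqb_refl : reflexive cquot_eqb.
Proof. by move=> x; apply/asboolP; rewrite mulVg; exact: gen1. Qed.

Fact cquot_eqb_sym : symmetric cquot_eqb.
Proof.
by move=> x y; apply/asboolP/asboolP => /genV; rewrite invgM invgK.
Qed.

Fact cquot_eqb_trans : transitive cquot_eqb.
Proof.
move=> y x z /asboolP xy /asboolP yz; apply/asboolP.
by have := genM xy yz; rewrite mulgA mulgK.
Qed.

Canonical cquot_equiv := EquivRel cquot_eqb
  cquot_eqb_refl cquot_eqb_sym cquot_eqb_trans.

(** The quotient of G by [U, G], which is the largest quotient of G in which
    the image of U is central. *)
Definition cquot : Type := {eq_quot cquot_equiv}.

HB.instance Definition _ := Choice.on cquot.

Definition cproj x : cquot := \pi_({eq_quot cquot_equiv}) x.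
Definition crepr (q : cquot) : G := repr (q : {eq_quot cquot_equiv}).

Lemma creprK q : cproj (crepr q) = q.
Proof. exact: reprK. Qed.

Lemma cprojP x y : cproj x = cproj y <-> V (x^-1 * y).
Proof.
by split=> [/eqmodP/asboolP | xy]; last by apply/eqmodP/asboolP.
Qed.

Let cmul (p q : cquot) : cquot := cproj (crepr p * crepr q).
Let cinv (p : cquot) : cquot := cproj (crepr p)^-1.

Let cmulE x y : cmul (cproj x) (cproj y) = cproj (x * y).
Proof.
apply/cprojP; have /cprojP Vx := creprK (cproj x).
have /cprojP Vy := creprK (cproj y).
have := genM (comm_subgroup_conj (crepr (cproj y)) Vx) Vy.
by rewrite conjgEr invgM !mulgA !(mulgK, mulgVK).
Qed.

Let cinvE x : cinv (cproj x) = cproj x^-1.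
Proof.
apply/cprojP; have /cprojP Vx := creprK (cproj x).
have /genV := comm_subgroup_conj x^-1 Vx.
by rewrite conjgEr !invgM !invgK !mulgA mulgV mul1g.
Qed.

Let cmulA : associative cmul.
Proof.
by move=> p q r; rewrite -[p]creprK -[q]creprK -[r]creprK !cmulE mulgA.
Qed.

Let cmul1 : left_id (cproj 1) cmul.
Proof. by move=> p; rewrite -[p]creprK cmulE mul1g. Qed.

Let cmulr1 : right_id (cproj 1) cmul.
Proof. by move=> p; rewrite -[p]creprK cmulE mulg1. Qed.

Let cmulV : left_inverse (cproj 1) cinv cmul.
Proof. by move=> p; rewrite -[p]creprK cinvE cmulE mulVg. Qed.

Let cmulrV : right_inverse (cproj 1) cinv cmul.
Proof. by move=> p; rewrite -[p]creprK cinvE cmulE mulgV. Qed.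

HB.instance Definition _ := isGroup.Build cquot
  cmulA cmul1 cmulr1 cmulV cmulrV.

Lemma cprojM x y : cproj (x * y) = cproj x * cproj y.
Proof. by rewrite -cmulE. Qed.

Fact cprojF : {morph cproj : x y / x / y}.
Proof. by move=> x y; rewrite cprojM -cinvE. Qed.

HB.instance Definition _ := isGroupMorphism.Build G cquot cproj cprojF.

Lemma cproj_eq1 x : cproj x = 1 <-> comm_subgroup U [set: G] x.
Proof.
rewrite -[1]/(cproj 1); split=> [/esym/cprojP|Vx].
  by rewrite invg1 mul1g.
by apply/esym/cprojP; rewrite invg1 mul1g.
Qed.

Lemma cproj_central u (q : cquot) : U u -> commute (cproj u) q.
Proof.
move=> Uu; apply/commgP; rewrite -[q]creprK -gmulfR; apply/eqP/cproj_eq1.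
by apply: gen_sub; exists u => //; exists (crepr q).
Qed.

End CentralQuotient.

(** * The residual relators *)

Section Commutation.
Variable G : groupType.
Implicit Types (A : set G) (x y z t : G).

Definition central z := forall x, commute z x.

Lemma central_commgV x y : central [~ x, y] -> central [~ y, x].
Proof.
by move=> xyC z; rewrite -invgR; apply/commute_sym/commuteV/commute_sym.
Qed.

Lemma central_zpow z k : central z -> central (z ^z k).
Proof. by move=> zC x; apply/commute_sym/commute_zpow/commute_sym. Qed.

Lemma centralM x y : central x -> central y -> central (x * y).
Proof.
by move=> xC yC z; apply/commute_sym/commuteM; apply/commute_sym.
Qed.

Lemma central_conj z x : central z -> z ^ x = z.
Proof. by move=> zC; apply/conjg_fixP/commgP/zC. Qed.

Lemma commute_conj x y z : commute x y -> commute (x ^ z) (y ^ z).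
Proof. by rewrite /commute -!conjMg => ->. Qed.

Lemma commgMr x y z : [~ x, y * z] = [~ x, z] * [~ x, y] ^ z.
Proof. by rewrite !commgE4 !conjgEr !invgM !mulgA !mulgK. Qed.

(** y^x = y [y, x] with [y, x] central, so that (y^k)^x = y^k [y, x]^k. *)
Lemma commg_zpowr x y k : central [~ x, y] -> [~ x, y ^z k] = [~ x, y] ^z k.
Proof.
move=> xyC; have yx : y ^ x = y * [~ y, x] by rewrite commgEl mulVKg.
have yxC := central_commgV xyC.
rewrite commgEr conjVg conj_zpow yx zpowMg; last exact: commute_sym.
by rewrite invgM mulgVK -(invgR y x) zpowV.
Qed.

Lemma commute_genr A x : (forall y, A y -> commute x y) ->
  forall y, gen_subgroup A y -> commute x y.
Proof.
move=> xA; apply: gen_ind => [|g z xg Az|g z xg Az]; first exact: commute1.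
  by apply: commuteM => //; exact: xA.
by apply: commuteM => //; apply/commuteV/xA.
Qed.

Lemma commute_gen A B : (forall x y, A x -> B y -> commute x y) ->
  forall x y, gen_subgroup A x -> gen_subgroup B y -> commute x y.
Proof.
move=> AB x y Ax; apply: commute_genr => z Bz; apply: commute_sym.
by move: Ax; apply: commute_genr => u Au; apply/commute_sym/AB.
Qed.

End Commutation.

Section RootChain.
Variables (G : groupType) (b t : G) (m n r s : int).
Hypothesis bezout : (m * r + n * s = 1)%R.
Hypothesis bt_rel : (b ^z m) ^ t = b ^z n.
Hypothesis bt_comm : forall i j : int, commute (b ^ (t ^z i)) (b ^ (t ^z j)).

Definition conj_closure : set G :=
  gen_subgroup [set x | exists i : int, x = b ^ (t ^z i)].

(** If b is thought of as 1 and t as the multiplication by n/m on Z[1/mn], then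
    root_chain k is 1/m^k: by the Bezout relation,
    1/m^(k+1) = r (1/m^k) + s (n/m) (1/m^k). *)
Fixpoint root_chain k : G :=
  if k is k'.+1 then root_chain k' ^z r * (root_chain k' ^ t) ^z s else b.

Lemma conj_closure_comm x y : conj_closure x -> conj_closure y -> commute x y.
Proof. by apply: commute_gen => _ _ [i ->] [j ->]. Qed.

Lemma conj_closure_conj x i : conj_closure x -> conj_closure (x ^ (t ^z i)).
Proof.
elim/gen_ind => [|g _ IH [j ->]|g _ IH [j ->]].
- by rewrite conj1g; exact: gen1.
- rewrite conjMg -conjgM -zpowD.
  by apply: genM => //; apply: gen_sub; exists (j + i)%R.
rewrite conjMg conjVg -conjgM -zpowD.
by apply: gen_div => //; apply: gen_sub; exists (j + i)%R.
Qed.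

Lemma conj_closureJ x : conj_closure x -> conj_closure (x ^ t).
Proof. by move=> /(conj_closure_conj 1). Qed.

Lemma root_chain_closure k : conj_closure (root_chain k).
Proof.
elim: k => [|k IH] /=; first by apply: gen_sub; exists 0%R; rewrite conjg1.
by apply: genM; apply: gen_zpow => //; exact: conj_closureJ.
Qed.

Let comm_t k i j : commute (root_chain k ^z i) ((root_chain k ^ t) ^z j).
Proof.
apply: commute_zpow2; apply: conj_closure_comm; first exact: root_chain_closure.
exact: conj_closureJ (root_chain_closure _).
Qed.

(** One step f, f^r (f^t)^s of the chain only needs the relation
    (f^t)^m = f^n, and passes it on to the next term. *)
Lemma root_chain_rel k :
  [/\ (root_chain k ^z m) ^ t = root_chain k ^z n,
      root_chain k.+1 ^z m = root_chain k &
      root_chain k.+1 ^z n = root_chain k ^ t].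
Proof.
have step f : (f ^z m) ^ t = f ^z n ->
    (forall i j, commute (f ^z i) ((f ^ t) ^z j)) ->
    (f ^z r * (f ^ t) ^z s) ^z m = f /\ (f ^z r * (f ^ t) ^z s) ^z n = f ^ t.
  rewrite conj_zpow => fm fC; rewrite !(zpowMg _ (fC _ _)); split.
    rewrite -!zpowM [(s * m)%R]mulrC [(f ^ t) ^z _]zpowM fm -zpowM -zpowD.
    by rewrite [(r * m)%R]mulrC bezout.
  rewrite -!zpowM [(r * n)%R]mulrC [f ^z _]zpowM -fm -zpowM -zpowD.
  by rewrite [(s * n)%R]mulrC bezout.
elim: k => [|k [f1 f2 f3]]; first by have [? ?] := step _ bt_rel (comm_t 0).
have f4 : (root_chain k.+1 ^z m) ^ t = root_chain k.+1 ^z n by rewrite f2.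
by have [? ?] := step _ f4 (comm_t k.+1).
Qed.

Lemma root_chain_pow k l : root_chain (k + l)%N ^z (m ^+ l)%R = root_chain k.
Proof.
elim: l => [|l IH]; first by rewrite addn0.
by have [_ fm _] := root_chain_rel (k + l); rewrite addnS exprS zpowM fm.
Qed.

Lemma root_chain_conj k l :
  root_chain (k + l)%N ^z (n ^+ l)%R = root_chain k ^ (t ^+ l).
Proof.
elim: l => [|l IH]; first by rewrite addn0 conjg1.
have [_ _ fn] := root_chain_rel (k + l).
by rewrite addnS exprS zpowM fn -conj_zpow IH expgSr conjgM.
Qed.

End RootChain.

Lemma gcdn_exp_dvd (d M N : nat) : (0 < d)%N ->
  (gcdn d (M ^ N) %| M ^ d)%N.
Proof.
move=> d0; have g0 : (0 < gcdn d (M ^ N))%N by rewrite gcdn_gt0 d0.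
apply/dvdn_partP => // p; rewrite mem_primes p_part => /and3P[p_pr _ pg].
have pM : (p %| M)%N.
  by have := dvdn_trans pg (dvdn_gcdr _ _); rewrite Euclid_dvdX // => /andP[].
apply: (@dvdn_trans (p ^ d)); last by rewrite dvdn_exp2r.
apply: dvdn_exp2l; apply: leq_trans (dvdn_leq d0 (dvdn_gcdl d (M ^ N))).
apply: leq_trans (dvdn_leq g0 (pfactor_dvdnn p _)).
exact: ltnW (ltn_expl _ (prime_gt1 p_pr)).
Qed.

Lemma zpow_gcd (G : groupType) (z : G) i j :
  z ^z i = 1 -> z ^z j = 1 -> z ^z (gcdz i j) = 1.
Proof.
move=> zi zj; have [u [v <-]] := Bezoutz i j.
by rewrite zpowD mulrC [(v * _)%R]mulrC !zpowM zi zj !zpow_one mulg1.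
Qed.

Lemma zpow_dvd (G : groupType) (z : G) i j :
  (i %| j)%Z -> z ^z i = 1 -> z ^z j = 1.
Proof. by move=> /dvdzP[k ->] zi; rewrite mulrC zpowM zi zpow_one. Qed.

(** The exponent of m in the conclusion does not depend on N. This uniformity
    is what makes a family z_k, with z_k = z_(k+1)^m and all orders dividing d,
    trivial as soon as z_0 is. *)
Lemma zpow_torsion (G : groupType) (z : G) (d N : nat) (m : int) :
  (0 < d)%N -> z ^+ d = 1 -> z ^z (m ^+ N)%R = 1 -> z ^z (m ^+ d)%R = 1.
Proof.
move=> d0 zd zN; apply: zpow_dvd (zpow_gcd (i := d) zd zN).
rewrite dvdzE /gcdz !absz_nat !abszX; exact: gcdn_exp_dvd.
Qed.

Section CentralCommutators.
Variables (G : groupType) (a t : G) (d : nat) (m n r s : int).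
Hypothesis d_gt0 : (0 < d)%N.
Hypothesis bezout : (m * r + n * s = 1)%R.
Let b := a ^+ d.
Hypothesis bt_rel : (b ^z m) ^ t = b ^z n.
Hypothesis comm_central : forall i : int, central [~ a, b ^ (t ^z i)].

Let rel_conj i : (b ^ (t ^z (i + 1)%R)) ^z m = (b ^ (t ^z i)) ^z n.
Proof.
by rewrite addrC zpowD zpow1 conjgM -!conj_zpow bt_rel.
Qed.

Lemma comm_central_pow i : [~ b, b ^ (t ^z i)] = [~ a, b ^ (t ^z i)] ^+ d.
Proof.
rewrite -invgR -[b in [~ _, b]]/(a ^z d) commg_zpowr.
  by rewrite -zpowV invgR.
exact: central_commgV.
Qed.

Let y i := [~ b, b ^ (t ^z i)].

Let y_central i : central (y i).
Proof. by rewrite /y comm_central_pow; apply: (central_zpow d). Qed.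

Let y_rel i : y (i + 1)%R ^z m = y i ^z n.
Proof.
rewrite -(commg_zpowr _ (y_central _)) rel_conj.
by rewrite (commg_zpowr _ (y_central _)).
Qed.

Let y_opp i : y (- i)%R = (y i)^-1.
Proof.
rewrite -[LHS](central_conj (t ^z i) (y_central _)).
by rewrite conjRg -conjgM -zpowD addNr conjg1 invgR.
Qed.

(** y is odd since conjugation by t^i fixes the central element y i, and
    y_rel at i and at - i - 1 shows that y (i + 1) is killed by both m and n,
    which are coprime. *)
Let y_nat (i : nat) : y i = 1.
Proof.
elim: i => [|i IH]; first by rewrite /y conjg1 commgg.
have ym : y i.+1 ^z m = 1 by rewrite -addn1 PoszD y_rel IH zpow_one.
have yn : y i.+1 ^z n = 1.
  apply: invg_inj; rewrite -zpowV -y_opp -y_rel -addn1 PoszD opprD addrNK.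
  by rewrite y_opp IH invg1 zpow_one.
by rewrite -[LHS]zpow1 -bezout zpowD !zpowM ym yn !zpow_one mulg1.
Qed.

Lemma conj_pow_comm i j : commute (b ^ (t ^z i)) (b ^ (t ^z j)).
Proof.
have bbi k : commute b (b ^ (t ^z k)).
  apply/commgP/eqP; case: (intP k) => [|l|l]; first exact: (y_nat 0).
    exact: (y_nat l.+1).
  by rewrite -/(y (- l.+1%:Z)%R) y_opp y_nat invg1.
have := commute_conj (t ^z i) (bbi (j - i)%R).
by rewrite -conjgM -zpowD subrK.
Qed.

Let f := root_chain b t r s.

Let clos_comm x : conj_closure b t x -> commute b x.
Proof.
apply: (conj_closure_comm conj_pow_comm).
by apply: gen_sub; exists 0%R; rewrite conjg1.
Qed.

Let clos_central x : conj_closure b t x -> central [~ a, x].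
Proof.
elim/gen_ind => [|g u gC [i ->]|g u gC [i ->]].
- by rewrite commg1 => z; apply/commute_sym/commute1.
- by rewrite commgMr (central_conj _ gC); apply: centralM.
rewrite commgMr (central_conj _ gC); apply: centralM => //.
have -> : (b ^ t ^z i)^-1 = (b ^ t ^z i) ^z (- 1)%R by rewrite zpowN.
by rewrite commg_zpowr //; apply: central_zpow.
Qed.

(** Now x |-> [a, x] is a homomorphism on the closure of b, with values of
    order dividing d; its values on the root chain are trivial by
    zpow_torsion. *)
Let f_comm k : [~ a, f k] = 1.
Proof.
have fC l : central [~ a, f l].
  exact: (clos_central (root_chain_closure r s l)).
have phi l j : [~ a, f (l + j)%N] ^z (m ^+ j)%R = [~ a, f l].
  by rewrite -commg_zpowr // (root_chain_pow bezout bt_rel conj_pow_comm).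
have phid l : [~ a, f l] ^+ d = 1.
  have /commgP/eqP := clos_comm (@root_chain_closure G b t r s l).
  rewrite -invgR -[b]/(a ^z d) commg_zpowr; last exact: central_commgV.
  by rewrite -zpowV invgR.
rewrite -(phi k d); apply: (@zpow_torsion _ _ d (k + d)) => //.
by have := phi 0%N (k + d)%N; rewrite add0n => ->; exact: commgXg.
Qed.

Lemma comm_conj_nat (i : nat) : [~ a, b ^ (t ^+ i)] = 1.
Proof.
have := root_chain_conj bezout bt_rel conj_pow_comm 0 i.
rewrite add0n => <-; rewrite commg_zpowr f_comm ?zpow_one //.
by move=> z; apply/commute_sym/commute1.
Qed.

End CentralCommutators.

(** Negative exponents reduce to positive ones: replacing t by its inverse
    exchanges m and n. *)
Lemma comm_conj_trivial (G : groupType) (a t : G) (d : nat) (m n r s : int) :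
  (0 < d)%N -> (m * r + n * s = 1)%R ->
  (a ^+ d ^z m) ^ t = a ^+ d ^z n ->
  (forall i : int, central [~ a, a ^+ d ^ (t ^z i)]) ->
  forall i : int, [~ a, a ^+ d ^ (t ^z i)] = 1.
Proof.
move=> d0 rs rel aC i; case: (intP i) => [|l|l].
- exact: (comm_conj_nat d0 rs rel aC 0).
- exact: (comm_conj_nat d0 rs rel aC l.+1).
rewrite zpowN zpow_nat -expVgn.
apply: (comm_conj_nat (m := n) (n := m) (r := s) (s := r) d0) => [||j].
- by rewrite addrC.
- by rewrite -rel conjgK.
by rewrite zpowV -zpowN.
Qed.

(** The powers z^e and z^e' are commutators with a t-conjugate of
    a^(e e'), which commutes with all t-conjugates of a. *)
Lemma comm_coprime_trivial (G : groupType) (a t : G) (e e' : nat) (i j : int) :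
  coprime e e' ->
  (forall k, [~ a, a ^+ (e * e') ^ (t ^z k)] = 1) ->
  let z := [~ (a ^+ e) ^ (t ^z i), (a ^+ e') ^ (t ^z j)] in
  central z -> z = 1.
Proof.
move=> ee' aB z zC.
have ab k l : commute (a ^ (t ^z k)) (a ^+ (e * e') ^ (t ^z l)).
  have /eqP/commgP := aB (l - k)%R.
  by move=> /(commute_conj (t ^z k)); rewrite -conjgM -zpowD subrK.
have ze : z ^z e%:Z = 1.
  rewrite -commg_zpowr // zpow_nat -conjXg -expgnA [(e' * e)%N]mulnC.
  by apply/eqP/commgP; rewrite conjXg; apply/commute_sym/commuteX/commute_sym.
have ze' : z ^z e'%:Z = 1.
  apply: invg_inj; rewrite invg1 -zpowV invgR -commg_zpowr; last first.
    exact: central_commgV.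
  rewrite zpow_nat -conjXg -expgnA.
  apply/eqP/commgP; rewrite [X in commute X]conjXg.
  exact/commute_sym/commuteX/commute_sym.
have := zpow_gcd ze ze'; rewrite /gcdz !absz_nat.
by move: ee'; rewrite /coprime => /eqP ->.
Qed.

Lemma central_base_trivial (G : groupType) (b t : G) (m n : int) :
  (`|n - m|)%R = 1%R -> (b ^z m) ^ t = b ^z n -> central b -> b = 1.
Proof.
move=> nm rel bC; have : b ^z (n - m)%R = 1.
  by rewrite zpowD zpowN -rel central_conj ?mulgV //; exact: central_zpow.
have [->|->] : (n - m = 1 \/ n - m = -1)%R by lia.
  by [].
by rewrite zpowN zpow1 => bV; apply: invg_inj; rewrite bV invg1.
Qed.

(** These elements die in every nilpotent quotient of the group generated by a
    and t with (b^m)^t = b^n, where b = a^d and delta = n - m. In a finite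
    nilpotent quotient b has order prime to m and n, so the group it generates
    is normalized by t and the t-conjugates of b are powers of b; the prime
    parts of a belong to different Sylow subgroups; and if delta is 1 or -1,
    then b or its inverse is the commutator [b^m, t], so that b goes down the
    lower central series forever. *)
Definition residual_relator (G : groupType) (a t : G) (d : nat) (delta : int) :
    set G :=
  [set x | [\/ exists i, x = [~ a, a ^+ d ^ (t ^z i)],
    exists e e' i j, [/\ (e * e')%N = d, coprime e e' &
      x = [~ (a ^+ e) ^ (t ^z i), (a ^+ e') ^ (t ^z j)]] |
    (`|delta|)%R = 1%R /\ x = a ^+ d]].

Lemma gmulf_zpow (G H : groupType) (f : UMagmaMorphism.type G H) x k :
  f (x ^z k) = f x ^z k.
Proof. by case: k => n /=; rewrite ?gmulfV gmulfXn. Qed.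

(** The key of the proof: in G / [U, G] the relators are central, and central
    relators are trivial. *)
Lemma residual_relator_comm (G : groupType) (a t : G) (d : nat)
    (m n r s : int) (U : set G) :
  (0 < d)%N -> (m * r + n * s = 1)%R -> (a ^+ d ^z m) ^ t = a ^+ d ^z n ->
  residual_relator a t d (n - m)%R `<=` U ->
  residual_relator a t d (n - m)%R `<=` comm_subgroup U [set: G].
Proof.
move=> d0 rs rel SU x; pose f := @cproj G U.
have fC y : residual_relator a t d (n - m)%R y -> central (f y).
  by move=> /SU Uy q; exact: cproj_central.
have frel : (f a ^+ d ^z m) ^ f t = f a ^+ d ^z n.
  by rewrite -gmulfXn -!gmulf_zpow -rel gmulfJ.
have aB i : [~ f a, f a ^+ d ^ (f t ^z i)] = 1.
  apply: comm_conj_trivial rs frel _ i => // i.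
  rewrite -gmulfXn -gmulf_zpow -gmulfJ -gmulfR.
  by apply: fC; constructor 1; exists i.
move=> Sx; apply/cproj_eq1; have := fC _ Sx.
case: Sx => [[i ->] _|[e [e' [i [j [ed ee' ->]]]]]|[dl ->]].
- by rewrite [LHS]gmulfR gmulfJ gmulfXn gmulf_zpow.
- rewrite [f _]gmulfR !gmulfJ !gmulfXn !gmulf_zpow.
  rewrite [LHS]gmulfR !gmulfJ !gmulfXn !gmulf_zpow.
  by apply: comm_coprime_trivial => //; rewrite ed.
rewrite [f _]gmulfXn [LHS]gmulfXn.
exact: central_base_trivial dl frel.
Qed.

(** Starting from U = G, the previous lemma descends the lower central series
    one term at a time, hence reaches the intersection W of its terms, and then
    takes one more step with U = W. *)
Lemma residual_relator_omega (G : groupType) (a t : G) (d : nat)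
    (m n r s : int) :
  (0 < d)%N -> (m * r + n * s = 1)%R -> (a ^+ d ^z m) ^ t = a ^+ d ^z n ->
  residual_relator a t d (n - m)%R `<=` comm_subgroup (lcs_omega G) [set: G].
Proof.
move=> d0 rs rel; apply: (residual_relator_comm d0 rs rel) => x Sx [|c] //= _.
elim: c x Sx => [//|c IH] x Sx.
exact: (residual_relator_comm d0 rs rel IH Sx).
Qed.

Local Open Scope ring_scope.

(** * Triangular representations and the lower central series *)

Section TriangularFiltration.
Variables (R : comNzRingType) (N : nat) (pi : R).
Implicit Types (A B : 'M[R]_N.+1) (c : nat).

(** Upper triangular matrices of weight at least c, when pi and each step above
    the diagonal have weight one. For pi = 0 these are the matrices that vanish
    below the c-th superdiagonal; a nilpotent pi leaves room, in 1 + tri_fil 1,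
    for diagonal entries that are congruent to 1 modulo pi. *)
Definition tri_fil c A :=
  forall i j : 'I_N.+1,
    ((i <= j)%N -> exists x, A i j = pi ^+ (c - (j - i)) * x) /\
    ((j < i)%N -> A i j = 0).

Lemma tri_fil0 c : tri_fil c 0.
Proof.
by move=> i j; split=> [_|_]; rewrite mxE //; exists 0; rewrite mulr0.
Qed.

Lemma tri_filD c A B : tri_fil c A -> tri_fil c B -> tri_fil c (A + B).
Proof.
move=> Ac Bc i j; rewrite mxE; split=> ij.
  have [x ->] := (Ac i j).1 ij; have [y ->] := (Bc i j).1 ij.
  by exists (x + y); rewrite mulrDr.
by rewrite (Ac i j).2 // (Bc i j).2 // addr0.
Qed.

Lemma tri_filN c A : tri_fil c A -> tri_fil c (- A).
Proof.
move=> Ac i j; rewrite mxE; split=> ij; last by rewrite (Ac i j).2 // oppr0.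
by have [x ->] := (Ac i j).1 ij; exists (- x); rewrite mulrN.
Qed.

Lemma sum_multiple (I : Type) (r : seq I) (x : I -> R) k :
  (forall i, exists y, x i = pi ^+ k * y) ->
  exists y, \sum_(i <- r) x i = pi ^+ k * y.
Proof.
move=> xk; elim: r => [|i r [y IH]]; first by exists 0; rewrite big_nil mulr0.
by rewrite big_cons IH; have [z ->] := xk i; exists (z + y); rewrite mulrDr.
Qed.

Lemma tri_filM c c' A B :
  tri_fil c A -> tri_fil c' B -> tri_fil (c + c') (A * B).
Proof.
move=> Ac Bc i j; rewrite mxE; split=> ij; last first.
  apply: big1 => k _; have [ki|ik] := ltnP k i.
    by rewrite (Ac i k).2 ?mul0r.
  by rewrite (Bc k j).2 ?mulr0 //; exact: leq_trans ik.
apply: sum_multiple => k.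
have [ki|ik] := ltnP k i; first by exists 0; rewrite (Ac i k).2 ?mul0r ?mulr0.
have [jk|kj] := ltnP j k; first by exists 0; rewrite (Bc k j).2 ?mulr0.
have [x ->] := (Ac i k).1 ik; have [y ->] := (Bc k j).1 kj.
have e : (c + c' - (j - i) <= (c - (k - i)) + (c' - (j - k)))%N by lia.
exists (pi ^+ ((c - (k - i)) + (c' - (j - k)) - (c + c' - (j - i))) * (x * y)).
by rewrite mulrACA -exprD -{1}(subnKC e) exprD -mulrA.
Qed.

Lemma tri_fil_le c c' A : (c' <= c)%N -> tri_fil c A -> tri_fil c' A.
Proof.
move=> cc Ac i j; split=> ij; last exact: (Ac i j).2.
have [x ->] := (Ac i j).1 ij.
exists (pi ^+ ((c - (j - i)) - (c' - (j - i))) * x).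
by rewrite mulrA -exprD subnKC // leq_sub2r.
Qed.

Lemma tri_fil_eq0 K A : pi ^+ K = 0 -> tri_fil (K + N) A -> A = 0.
Proof.
move=> piK Ac; apply/matrixP => i j; rewrite mxE.
have [ji|ij] := ltnP j i; first exact: (Ac i j).2.
have [x ->] := (Ac i j).1 ij.
have jN : (j - i <= N)%N by rewrite (leq_trans (leq_subr _ _)) // -ltnS.
by rewrite -addnBA // exprD piK !mul0r.
Qed.

End TriangularFiltration.

Definition is_rep (G : groupType) (R : nzRingType) (rho : G -> R) :=
  rho 1%g = 1 /\ forall x y, rho (x * y)%g = rho x * rho y.

Section Representations.
Variables (G : groupType) (R : nzRingType) (rho : G -> R).
Hypothesis rho_rep : is_rep rho.

Lemma rep1 : rho 1%g = 1. Proof. exact: rho_rep.1. Qed.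
Lemma repM x y : rho (x * y)%g = rho x * rho y. Proof. exact: rho_rep.2. Qed.
Lemma repX x n : rho (x ^+ n)%g = rho x ^+ n.
Proof. by elim: n => [|n IH]; rewrite ?expg0 ?rep1 // expgS repM IH exprS. Qed.
Lemma rep_mulV x : rho x * rho x^-1%g = 1.
Proof. by rewrite -repM mulgV rep1. Qed.
Lemma rep_mulVl x : rho x^-1%g * rho x = 1.
Proof. by rewrite -repM mulVg rep1. Qed.

Lemma repV1 x : rho x = 1 -> rho x^-1%g = 1.
Proof. by move=> x1; have := rep_mulV x; rewrite x1 mul1r. Qed.

Lemma rep_gen1 (A : set G) :
  (forall x, A x -> rho x = 1) -> forall x, gen_subgroup A x -> rho x = 1.
Proof.
move=> A1 x; elim/gen_ind => [|g u g1 /A1 u1|g u g1 /A1 u1]; first exact: rep1.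
  by rewrite repM g1 u1 mul1r.
by rewrite repM g1 repV1 // mul1r.
Qed.

Lemma rep_zpow1 x k : rho x = 1 -> rho (x ^z k)%g = 1.
Proof. by move=> x1; case: k => n /=; rewrite ?repV1 // repX x1 expr1n. Qed.

Lemma rep_conj1 x y : rho x = 1 -> rho (x ^ y)%g = 1.
Proof. by move=> x1; rewrite conjgEr !repM x1 mulr1 rep_mulVl. Qed.

End Representations.

Section ResidualDetection.
Variables (G : groupType) (R : comNzRingType) (N : nat) (pi : R).
Variable rho : G -> 'M[R]_N.+1.
Hypothesis rho_rep : is_rep rho.
Hypothesis rho_fil : forall g, tri_fil pi 1 (rho g - 1).

(** With x, y standing for their matrices,
    [x, y] - 1 = x^-1 y^-1 ((x - 1) (y - 1) - (y - 1) (x - 1)), so commutators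
    add weights. *)
Lemma lcs_tri_fil c g : (0 < c)%N -> lcs G c g -> tri_fil pi c (rho g - 1).
Proof.
case: c => // c _; elim: c g => [|c IH] g; first by move=> _; exact: rho_fil.
have mulfil k x A : tri_fil pi k A -> tri_fil pi k (rho x * A).
  move=> Ak; rewrite -[rho x](subrK 1) mulrDl mul1r.
  by apply: tri_filD => //; apply: tri_fil_le (tri_filM (rho_fil x) Ak); lia.
have Mfil k x y : tri_fil pi k (rho x - 1) -> tri_fil pi k (rho y - 1) ->
    tri_fil pi k (rho (x * y)%g - 1).
  move=> xk yk; have -> : rho (x * y)%g - 1 = rho x * (rho y - 1) + (rho x - 1).
    by rewrite (repM rho_rep) mulrBr mulr1 addrA subrK.
  by apply: tri_filD => //; apply: mulfil.
have Vfil k x : tri_fil pi k (rho x - 1) -> tri_fil pi k (rho x^-1%g - 1).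
  move=> xk; have -> : rho x^-1%g - 1 = - (rho x^-1%g * (rho x - 1)).
    by rewrite mulrBr mulr1 (rep_mulVl rho_rep) opprB.
  exact/tri_filN/mulfil.
have Rfil x y : tri_fil pi c.+1 (rho x - 1) ->
    tri_fil pi c.+2 (rho [~ x, y]%g - 1).
  move=> xc; have -> : rho [~ x, y]%g - 1 = rho x^-1%g * (rho y^-1%g *
      ((rho x - 1) * (rho y - 1) - (rho y - 1) * (rho x - 1))).
    have -> : (rho x - 1) * (rho y - 1) - (rho y - 1) * (rho x - 1) =
        rho x * rho y - rho y * rho x.
      rewrite !mulrBl !mulrBr !mul1r !mulr1.
      rewrite -[_ - rho x - _]addrA -[_ - rho y - _]addrA.
      have -> : - rho x + - (rho y - 1) = - rho y + - (rho x - 1).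
        by rewrite !opprB addrCA [RHS]addrCA [- rho x + _]addrC.
      by rewrite [- (_ + (_ + _))]opprD addrACA subrr addr0.
    rewrite commgE4 !(repM rho_rep) !mulrBr !mulrA.
    rewrite -[_ * rho y^-1%g * rho y]mulrA (rep_mulVl rho_rep).
    by rewrite mulr1 (rep_mulVl rho_rep).
  apply/mulfil/mulfil/tri_filD; last apply/tri_filN.
    by rewrite -addn1; apply: tri_filM.
  by rewrite -add1n; apply: tri_filM.
elim/gen_ind => [|h u hc [x xc [y _ ->]]|h u hc [x xc [y _ ->]]].
- by rewrite (rep1 rho_rep) subrr; exact: tri_fil0.
- by apply: Mfil => //; exact/Rfil/IH.
by apply: Mfil => //; exact/Vfil/Rfil/IH.
Qed.

Lemma rep_omega K g : pi ^+ K = 0 -> lcs_omega G g -> rho g = 1.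
Proof.
move=> piK gw; apply/eqP; rewrite -subr_eq0; apply/eqP.
apply: (tri_fil_eq0 piK); apply: (@tri_fil_le _ _ _ (K + N).+1) => //.
by apply: lcs_tri_fil => //; exact: gw.
Qed.

Lemma rep_cquot U : (forall u, U u -> rho u = 1) ->
  exists2 rho' : cquot U -> 'M[R]_N.+1,
    is_rep rho' & forall g, rho' (cproj U g) = rho g.
Proof.
move=> rhoU; have rhoV x : comm_subgroup U [set: G] x -> rho x = 1.
  apply: (rep_gen1 rho_rep) => _ [u /rhoU u1 [h _ ->]].
  rewrite commgEl (repM rho_rep) (repV1 rho_rep) //.
  by rewrite (rep_conj1 rho_rep) // mulr1.
have rhoP g : rho (crepr (cproj U g)) = rho g.
  have /cprojP/rhoV := creprK (cproj U g); rewrite (repM rho_rep) => h.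
  by rewrite -[LHS]mulr1 -h mulrA (rep_mulV rho_rep) mul1r.
exists (fun q => rho (crepr q)); last exact: rhoP.
split=> [|p q]; first by rewrite -[1%g]/(cproj U 1%g) rhoP (rep1 rho_rep).
by rewrite -[in LHS](creprK p) -[in LHS](creprK q) -gmulfM rhoP (repM rho_rep).
Qed.

End ResidualDetection.

(** * Presentations and representations of Baumslag-Solitar groups *)

Section BaumslagSolitar.
Variables m n : int.
Local Notation G := (BS m n).

Definition bs_elt (x : bs_gen) : G := pres_class (bs_rel m n) [:: (x, false)].

Lemma bs_class_cat u v :
  (pres_class (bs_rel m n) (u ++ v) : G) =
  ((pres_class (bs_rel m n) u : G) * (pres_class (bs_rel m n) v : G))%g.
Proof.
apply/esym/pres_classP.
by apply: pres_cat; exact: pres_classK.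
Qed.

Lemma bs_class_inv x :
  (pres_class (bs_rel m n) [:: (x, true)] : G) = (bs_elt x)^-1%g.
Proof.
apply/esym/mulg1_eq; rewrite -bs_class_cat; apply/pres_classP.
exact: pres_cancel x false.
Qed.

Lemma bs_class_pow x k :
  (pres_class (bs_rel m n) (gen_pow x k) : G) = (bs_elt x ^z k)%g.
Proof.
have powE b j : (pres_class (bs_rel m n) (nseq j (x, b)) : G) =
    ((pres_class (bs_rel m n) [:: (x, b)] : G) ^+ j)%g.
  by elim: j => [//|j IH]; rewrite expgS -IH -bs_class_cat.
case: k => k; first exact: (powE false k).
by apply: etrans (powE true k.+1) _; rewrite bs_class_inv expVgn.
Qed.

Lemma bs_relation : ((bs_elt bs_a ^z m) ^ bs_elt bs_t)%g = (bs_elt bs_a ^z n)%g.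
Proof.
rewrite -!bs_class_pow conjgEr -bs_class_inv -mulgA.
rewrite -(bs_class_cat (gen_pow _ _)) -bs_class_cat.
by apply/pres_classP; apply: pres_rel.
Qed.

Lemma bs_generated g :
  gen_subgroup [set x | x = bs_elt bs_a \/ x = bs_elt bs_t] g.
Proof.
rewrite -[g]pres_wordK; elim: (pres_word g) => [|[x b] w IH]; first exact: gen1.
rewrite -cat1s bs_class_cat; apply: genM => //.
have xG : gen_subgroup [set x | x = bs_elt bs_a \/ x = bs_elt bs_t] (bs_elt x).
  by apply: gen_sub; case: x; [left|right].
by case: b; [rewrite bs_class_inv; apply: genV|].
Qed.

Section Evaluation.
Variables (R : nzRingType) (A A' T T' : R).
Hypotheses (AA' : A * A' = 1) (A'A : A' * A = 1).
Hypotheses (TT' : T * T' = 1) (T'T : T' * T = 1).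
Hypothesis rel :
  T' * (if (m < 0)%R then A' else A) ^+ `|m| * T =
  (if (n < 0)%R then A' else A) ^+ `|n|.

Let img (l : bs_gen * bool) : R :=
  match l with
  | (bs_a, false) => A | (bs_a, true) => A'
  | (bs_t, false) => T | (bs_t, true) => T'
  end.

Let ev w : R := \prod_(l <- w) img l.

Let ev_pow x k : ev (gen_pow x k) = img (x, (k < 0)%R) ^+ `|k|.
Proof. by rewrite /ev /gen_pow big_nseq -Monoid.iteropE. Qed.

Let ev_eq u v : pres_eq (bs_rel m n) u v -> ev u = ev v.
Proof.
elim=> [{}u {}v [-> ->]|x b|{}u u' {}v v' _ IH _ IH'|//|//|w {}u {}v _ -> _ //].
- rewrite ev_pow /ev !big_cat /= -![\prod_(i <- _) _]/(ev _) !ev_pow /=.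
  by rewrite mulrA !expr1 -[RHS]/(img (bs_a, _) ^+ _) /img -rel.
- by rewrite /ev !big_cons !big_nil mulr1; case: x; case: b.
by rewrite /ev !big_cat /=; congr (_ * _).
Qed.

Lemma bs_rep : exists rho : G -> R,
  [/\ is_rep rho, rho (bs_elt bs_a) = A, rho (bs_elt bs_t) = T,
      rho (bs_elt bs_a)^-1%g = A' & rho (bs_elt bs_t)^-1%g = T'].
Proof.
exists (fun g => ev (pres_word g)).
have evE w : ev (pres_word (pres_class (bs_rel m n) w)) = ev w.
  exact/ev_eq/pres_classK.
have ev1 l : ev [:: l] = img l by rewrite /ev big_cons big_nil mulr1.
split; rewrite -?bs_class_inv ?evE ?ev1 //; split=> [|x y].
  by rewrite evE /ev big_nil.
by rewrite evE /ev big_cat.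
Qed.

End Evaluation.

End BaumslagSolitar.

(** * Magnus matrices *)

(** From j C(p^e, j) = p^e C(p^e - 1, j - 1). *)
Lemma dvdn_bin_pexp p e j :
  prime p -> (0 < j < p ^ e)%N -> (p %| 'C(p ^ e, j))%N.
Proof.
move=> p_pr /andP[j0 je]; apply: contraLR je.
rewrite -leqNgt -(prime_coprime _ p_pr).
move=> pC; apply: dvdn_leq => //.
have := mul_bin_diag (p ^ e) j.-1; rewrite (prednK j0) => eC.
have : (p ^ e %| j * 'C(p ^ e, j))%N by rewrite -eC dvdn_mulr.
by rewrite Gauss_dvdl // coprimeXl.
Qed.

Section MagnusMatrices.
Variables (R : comNzRingType) (N : nat) (l : nat -> bool).
Implicit Types (g : bool) (k : nat).

Definition same_letter g i j := all (fun q => l q == g) (index_iota i j).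

Lemma same_letterP g i j q :
  same_letter g i j -> (i <= q < j)%N -> l q = g.
Proof. by move=> /allP h iqj; apply/eqP/h; rewrite mem_index_iota. Qed.

Lemma same_letterS g i j : (i <= j)%N ->
  same_letter g i j.+1 = same_letter g i j && (l j == g).
Proof.
move=> ij; rewrite /same_letter /index_iota subSn // -addn1 iotaD all_cat /=.
by rewrite subnKC // andbT.
Qed.

(** The k-th power of 1 + S, where S moves the position i to i + 1 if the
    letter l i between them is g. *)
Definition magnus_mx g k : 'M[R]_N.+1 :=
  \matrix_(i, j)
    (if (i <= j)%N && same_letter g i j then 'C(k, j - i)%:R else 0).

Let shift g : 'M[R]_N.+1 :=
  \matrix_(i, j) ((j == i.+1 :> nat) && (l i == g))%:R.

Lemma magnus_mx0 g : magnus_mx g 0 = 1.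
Proof.
apply/matrixP => i j; rewrite !mxE bin0n subn_eq0.
have [ij|ij] := eqVneq i j.
  by rewrite ij leqnn /same_letter /index_iota subnn.
case: (ltngtP i j) => //= ij'; first by case: ifP.
by rewrite (ord_inj ij') eqxx in ij.
Qed.

Lemma magnus_mxS g k : magnus_mx g k.+1 = magnus_mx g k * (1 + shift g).
Proof.
apply/matrixP => i j; rewrite mulrDr mulr1 !mxE.
case: j => [[|j] jN] /=.
  rewrite big1 ?addr0 => [|q _]; last by rewrite !mxE mulr0.
  by case: ifP => // /andP[i0 _]; rewrite sub0n !bin0.
have jN' : (j < N.+1)%N by exact: ltnW.
rewrite (bigD1 (Ordinal jN')) //= big1 ?addr0 => [|q qj]; last first.
  rewrite !mxE /= eqSS; case: eqP => /= [jq|_]; last by rewrite mulr0.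
  by case/eqP: qj; apply: ord_inj.
rewrite !mxE /= eqxx /=; case: (ltngtP i j.+1) => /= ij.
- rewrite -ltnS ij (same_letterS _ (ij : (i <= j)%N)) (subSn (ij : (i <= j)%N)).
  rewrite binS natrD.
  by case: (same_letter _ _ _); case: (l j == g);
    rewrite /= ?mulr1 ?mulr0 ?addr0 ?mul0r.
- by rewrite leqNgt (ltnW ij) /= mul0r addr0.
by rewrite -ltnS ij ltnn /= mul0r addr0 subnn !bin0.
Qed.

Lemma magnus_mxX g k : magnus_mx g k = magnus_mx g 1 ^+ k.
Proof.
have e1 : magnus_mx g 1 = 1 + shift g by rewrite magnus_mxS magnus_mx0 mul1r.
elim: k => [|k IH]; first exact: magnus_mx0.
by rewrite exprSr -IH e1 magnus_mxS.
Qed.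

Lemma magnus_mx_fil g k : tri_fil (0 : R) 1 (magnus_mx g k - 1).
Proof.
move=> i j; rewrite !mxE; split=> ij; last first.
  rewrite leqNgt ij /= sub0r; have [ij'|] := eqVneq i j; last by rewrite oppr0.
  by rewrite ij' ltnn in ij.
have [ij'|ij'] := eqVneq i j.
  rewrite ij' leqnn /same_letter /index_iota subnn /= bin0 subrr.
  by exists 0; rewrite mulr0.
have -> : (1 - (j - i) = 0)%N.
  have : (i != j :> nat) by []. by lia.
by rewrite expr0; eexists; rewrite mul1r.
Qed.

End MagnusMatrices.
Definition letters (ws : seq (bool * nat)) : seq bool :=
  flatten [seq nseq s.2 s.1 | s <- ws].

Definition alternating (T : Type) (ws : seq (bool * T)) : bool :=
  sorted (fun s s' => s.1 != s'.1) ws.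

Lemma letters_cons g k ws : letters ((g, k) :: ws) = nseq k g ++ letters ws.
Proof. by []. Qed.

Lemma nth_letters_head g k ws q :
  (q < k)%N -> nth false (letters ((g, k) :: ws)) q = g.
Proof. by move=> qk; rewrite letters_cons nth_cat size_nseq qk nth_nseq qk. Qed.

Lemma letters_next g k ws : alternating ((g, k) :: ws) ->
  all (fun s => 0 < s.2)%N ws -> (0 < size (letters ws))%N ->
  nth false (letters ((g, k) :: ws)) k != g.
Proof.
rewrite letters_cons nth_cat size_nseq ltnn subnn.
case: ws => [//|[h k'] ws] /= /andP[gh _] /andP[k'0 _] _.
by rewrite (nth_letters_head _ _ k'0) eq_sym.
Qed.

(** Adjacent syllables carry different letters, so a run of equal letters stays
    inside one syllable. *)
Lemma letters_run (P : bool -> nat) ws g i : (0 < P g)%N ->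
  alternating ws -> all (fun s => 0 < s.2 < P s.1)%N ws ->
  (i + P g <= size (letters ws))%N ->
  ~~ same_letter (nth false (letters ws)) g i (i + P g).
Proof.
move=> P0; elim: ws i => [|[h k] ws IH] i.
  by rewrite leqn0 addn_eq0 -[P g == _]negbK -lt0n P0 andbF.
move=> alt /= /andP[/andP[k0 kP] ws0].
rewrite [letters _]letters_cons size_cat size_nseq -/(letters ws) => iP.
apply/negP => run; have [ik|ki] := ltnP i k.
  have gh : g = h.
    rewrite -(same_letterP run (q := i)) ?nth_cat ?size_nseq ?ik ?nth_nseq
      ?ik //.
    by rewrite leqnn -[X in (X < _)%N]addn0 ltn_add2l.
  have ws_pos : all (fun s => 0 < s.2)%N ws.
    by apply: sub_all ws0 => w /andP[].
  subst h; have sz : (0 < size (letters ws))%N by lia.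
  case/eqP: (letters_next alt ws_pos sz); rewrite letters_cons.
  by apply: (same_letterP run); rewrite (ltnW ik) /=; lia.
have iP' : (i - k + P g <= size (letters ws))%N by lia.
case/negP: (IH _ (path_sorted alt) ws0 iP'); apply/allP => q.
rewrite mem_index_iota => /andP[q1 q2]; apply/eqP.
have <- : nth false (nseq k h ++ letters ws) (k + q)%N = g.
  by apply: (same_letterP run); lia.
by rewrite nth_cat size_nseq ltnNge leq_addr /= addKn.
Qed.

Section RowStep.
Variables (R : comNzRingType) (N : nat) (l : nat -> bool).

(** Position s is the end of the syllables read so far. A path of letters g
    that reaches s + k must start at s, because the letter before s is not g,
    and it contributes the coefficient C(k, k) = 1; no path goes beyond s + k,
    because the next letter is not g. *)
Lemma magnus_row_step g k s (v : 'rV[R]_N.+1) :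
  (0 < k)%N -> (forall q, (s <= q < s + k)%N -> l q = g) ->
  ((0 < s)%N -> l s.-1 != g) -> ((s + k < N)%N -> l (s + k)%N != g) ->
  (forall j : 'I_N.+1, (s < j)%N -> v 0 j = 0) ->
  (forall j : 'I_N.+1, j = s :> nat -> v 0 j != 0) ->
  let v' := v *m magnus_mx R N l g k in
  (forall j : 'I_N.+1, (s + k < j)%N -> v' 0 j = 0) /\
  (forall j : 'I_N.+1, j = (s + k)%N :> nat -> v' 0 j != 0).
Proof.
move=> k0 run prev next v0 vs v'; split=> j js.
  rewrite mxE; apply: big1 => i _; have [si|si] := ltnP s i.
    by rewrite v0 // mul0r.
  rewrite mxE; case: ifP => [/andP[ij ijg]|_]; last by rewrite mulr0.
  have skN : (s + k < N)%N by rewrite (leq_trans js) // -ltnS.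
  case/eqP: (next skN); apply: (same_letterP ijg).
  by rewrite js andbT (leq_trans si) // leq_addr.
have sN : (s < N.+1)%N by rewrite (leq_ltn_trans _ (ltn_ord j)) // js leq_addr.
rewrite mxE (bigD1 (Ordinal sN)) //= big1 ?addr0 => [|i is_].
  rewrite mxE /= js leq_addr /= addKn binn.
  have -> : same_letter l g s (s + k).
    by apply/allP => q; rewrite mem_index_iota => /run ->.
  by rewrite mulr1 vs.
have [si|si] := ltnP s i; first by rewrite v0 // mul0r.
have {}si : (i < s)%N.
  rewrite ltn_neqAle si andbT.
  by apply: contraNneq is_ => is_; apply/eqP/ord_inj.
rewrite mxE; case: ifP => [/andP[ij ijg]|_]; last by rewrite mulr0.
case/eqP: (prev (leq_ltn_trans (leq0n _) si)).
by apply: (same_letterP ijg); rewrite js; lia.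
Qed.

Lemma magnus_row_prod ws s (v : 'rV[R]_N.+1) :
  alternating ws -> all (fun s => 0 < s.2)%N ws ->
  (s + size (letters ws) = N)%N ->
  (forall q, (q < size (letters ws))%N ->
     l (s + q)%N = nth false (letters ws) q) ->
  ((0 < s)%N -> if ws is w :: _ then l s.-1 != w.1 else true) ->
  (forall j : 'I_N.+1, (s < j)%N -> v 0 j = 0) ->
  (forall j : 'I_N.+1, j = s :> nat -> v 0 j != 0) ->
  (v *m \prod_(w <- ws) magnus_mx R N l w.1 w.2) 0 ord_max != 0.
Proof.
elim: ws s v => [|[g k] ws IH] s v alt pos sN lws prev v0 vs.
  by rewrite big_nil mulmx1 vs //= -sN addn0.
move: pos => /= /andP[k0 pos].
have szE : size (letters ((g, k) :: ws)) = (k + size (letters ws))%N.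
  by rewrite letters_cons size_cat size_nseq.
have run q : (s <= q < s + k)%N -> l q = g.
  move=> /andP[sq qk]; rewrite -(subnKC sq) lws; last by lia.
  by rewrite nth_letters_head //; lia.
have next : (s + k < N)%N -> l (s + k)%N != g.
  by move=> skN; rewrite lws ?letters_next //; lia.
have [v'0 v's] := magnus_row_step k0 run prev next v0 vs.
rewrite big_cons -mulmxE mulmxA; apply: IH v'0 v's => //.
- exact: path_sorted alt.
- by rewrite -addnA -szE.
- move=> q qs; rewrite -addnA lws; last by lia.
  by rewrite letters_cons nth_cat size_nseq ltnNge leq_addr /= addKn.
move=> _; case: ws alt {pos sN lws szE next} => [//|w ws] /= /andP[gw _].
by rewrite run //; lia.
Qed.

End RowStep.

Lemma magnus_mx_pexp (p e N : nat) (l : nat -> bool) g : prime p ->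
  (forall i, (i + p ^ e <= N)%N -> ~~ same_letter l g i (i + p ^ e)) ->
  magnus_mx 'F_p N l g (p ^ e) = 1.
Proof.
move=> p_pr norun; apply/matrixP => i j; rewrite !mxE.
have [->|ij] := eqVneq i j.
  by rewrite leqnn subnn bin0 /same_letter /index_iota subnn.
case: ifP => // /andP[ij' run]; rewrite mulr0n.
have {}ij' : (i < j)%N by rewrite ltn_neqAle ij.
have jp : (j - i < p ^ e)%N.
  rewrite ltnNge; apply/negP => pj.
  have ipj : (i + p ^ e <= j)%N by lia.
  case/negP: (norun i (leq_trans ipj (ltn_ord j : (j <= N)%N))).
  apply/allP => q; rewrite mem_index_iota => /andP[q1 q2]; apply/eqP.
  by apply: (same_letterP run); lia.
have /dvdnP[c ->] : (p %| 'C(p ^ e, j - i))%N.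
  by apply: dvdn_bin_pexp => //; rewrite jp subn_gt0 ij'.
by rewrite natrM pchar_Fp_0 ?mulr0.
Qed.

(** The letter false generates a cyclic group of order p^(e false), the letter
    true one of order p^(e true), and the word ws is a non-trivial element of
    their free product. The matrices are those of the path spelled by ws itself:
    reading ws along the path from one end to the other gives an entry 1 in the
    top right corner. *)
Lemma magnus_detect (p : nat) (e : bool -> nat) (ws : seq (bool * nat)) :
  prime p -> alternating ws -> all (fun w => 0 < w.2 < p ^ e w.1)%N ws ->
  ws != [::] ->
  exists (N : nat) (A : bool -> 'M['F_p]_N.+1),
    [/\ forall g, A g ^+ (p ^ e g) = 1, forall g k, tri_fil 0 1 (A g ^+ k - 1) &
        \prod_(w <- ws) A w.1 ^+ w.2 != 1].
Proof.
move=> p_pr alt wsP ws0; pose l := nth false (letters ws).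
pose N := size (letters ws); exists N, (fun g => magnus_mx 'F_p N l g 1).
have ws_pos : all (fun w => 0 < w.2)%N ws.
  by apply: sub_all wsP => w /andP[].
split=> [g|g k|].
- rewrite -magnus_mxX; apply: magnus_mx_pexp => // i.
  apply: (letters_run (P := fun g => (p ^ e g)%N)) => //.
  by rewrite expn_gt0 prime_gt0.
- by rewrite -magnus_mxX; exact: magnus_mx_fil.
under eq_bigr do rewrite -magnus_mxX.
have N0 : (0 < N)%N.
  rewrite /N; case: (ws) ws0 ws_pos => [//|[g k] ws'] _ /= /andP[k0 _].
  by rewrite letters_cons size_cat size_nseq addn_gt0 k0.
have := @magnus_row_prod 'F_p N l ws 0 (delta_mx 0 0) alt ws_pos erefl.
rewrite -rowE mxE => h.
have {h} : (\prod_(w <- ws) magnus_mx 'F_p N l w.1 w.2) 0 ord_max != 0.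
  apply: h => // j j0; rewrite !mxE.
    by rewrite eqxx /=; case: (j =P 0) j0 => [->|].
  have -> : j = 0 by apply: ord_inj.
  by rewrite !eqxx oner_eq0.
apply: contraNneq => ->; rewrite mxE.
rewrite (_ : (0 == ord_max) = false) //; apply/negP.
by move=> /eqP/(congr1 (@nat_of_ord _)) /= h; move: N0; rewrite -h.
Qed.

(** * Unipotent and affine representations *)

Section BSFiltration.
Variables (m n : int) (R : comNzRingType) (N : nat) (pi : R).
Local Notation G := (BS m n).
Local Notation a := (bs_elt m n bs_a).
Local Notation t := (bs_elt m n bs_t).

Lemma bs_rep_fil (rho : G -> 'M[R]_N.+1) : is_rep rho ->
  tri_fil pi 1 (rho a - 1) -> tri_fil pi 1 (rho a^-1%g - 1) ->
  tri_fil pi 1 (rho t - 1) -> tri_fil pi 1 (rho t^-1%g - 1) ->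
  forall g, tri_fil pi 1 (rho g - 1).
Proof.
move=> rho_rep ra ra' rt rt' g.
have Mfil x y : tri_fil pi 1 (rho x - 1) -> tri_fil pi 1 (rho y - 1) ->
    tri_fil pi 1 (rho (x * y)%g - 1).
  move=> x1 y1; have -> : rho (x * y)%g - 1 =
      (rho x - 1) * (rho y - 1) + ((rho x - 1) + (rho y - 1)).
    rewrite (repM rho_rep) -{1}[rho x](subrK 1) -{1}[rho y](subrK 1).
    by rewrite mulrDl mulrDr mulr1 mul1r addrA addrK -[LHS]addrA.
  apply: tri_filD; last exact: tri_filD.
  exact: tri_fil_le (tri_filM x1 y1).
elim/gen_ind: (bs_generated g) => [|x y xf [->|->]|x y xf [->|->]];
  try exact: Mfil.
by rewrite (rep1 rho_rep) subrr; exact: tri_fil0.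
Qed.

Lemma unipotent_rep (A : bool -> 'M[R]_N.+1) (P : bool -> nat) :
  (forall g, (0 < P g)%N) -> (forall g, A g ^+ P g = 1) ->
  (forall g k, tri_fil pi 1 (A g ^+ k - 1)) ->
  (P false %| `|m|)%N -> (P false %| `|n|)%N ->
  exists rho : G -> 'M[R]_N.+1,
    [/\ is_rep rho, rho a = A false, rho t = A true &
        forall g, tri_fil pi 1 (rho g - 1)].
Proof.
move=> P0 AP Af Pm Pn.
have pow1 b k : (P false %| k)%N ->
    (if b then A false ^+ (P false).-1 else A false) ^+ k = 1.
  move=> /dvdnP[q ->]; case: b; last by rewrite mulnC exprM AP expr1n.
  by rewrite -exprM mulnA mulnC exprM AP expr1n.
have [||||| rho [rho_rep ra rt ra' rt']] :=
  @bs_rep m n 'M[R]_N.+1 (A false) (A false ^+ (P false).-1)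
    (A true) (A true ^+ (P true).-1).
- by rewrite -exprS prednK.
- by rewrite -exprSr prednK.
- by rewrite -exprS prednK.
- by rewrite -exprSr prednK.
- by rewrite !pow1 // mulr1 -exprSr prednK.
exists rho; split=> //; apply: bs_rep_fil => //.
- by rewrite ra -[A false]expr1.
- by rewrite ra'.
- by rewrite rt -[A true]expr1.
by rewrite rt'.
Qed.

End BSFiltration.

(** The geometric series. *)
Lemma unit_mod_nilpotent (R : comNzRingType) (x y : R) K :
  x ^+ K = 0 -> y = 1 - x -> exists z, y * z = 1.
Proof.
move=> xK ->; exists (\sum_(i < K) x ^+ i).
have := subrX1 x K; rewrite xK sub0r => /(congr1 -%R).
by rewrite opprK -mulNr opprB.
Qed.

Section AffineRepresentation.
Variables (R : comNzRingType).

Definition transl (k : R) : 'M[R]_2 :=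
  \matrix_(i, j) (if i == j then 1 else if i == 0 then k else 0).
Definition dilat (v : R) : 'M[R]_2 :=
  \matrix_(i, j) (if i == j then if i == 0 then 1 else v else 0).

Lemma mx2P (A B : 'M[R]_2) :
  [/\ A 0 0 = B 0 0, A 0 1 = B 0 1, A 1 0 = B 1 0 & A 1 1 = B 1 1] -> A = B.
Proof.
move=> [e00 e01 e10 e11]; apply/matrixP => i j.
have two (k : 'I_2) : k = 0 \/ k = 1.
  by case: k => [[|[|//]] k2]; [left|right]; apply: ord_inj.
by case: (two i) => ->; case: (two j) => ->.
Qed.

Lemma translM k k' : transl k * transl k' = transl (k + k').
Proof.
by apply: mx2P; split; rewrite !mxE !big_ord_recl big_ord0 !mxE /=; ring.
Qed.

Lemma transl0 : transl 0 = 1.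
Proof. by apply: mx2P; split; rewrite !mxE. Qed.

Lemma translX k j : transl k ^+ j = transl (k *+ j).
Proof.
elim: j => [|j IH]; first by rewrite mulr0n transl0.
by rewrite exprS IH translM mulrS.
Qed.

Lemma dilatM v v' : dilat v * dilat v' = dilat (v * v').
Proof.
by apply: mx2P; split; rewrite !mxE !big_ord_recl big_ord0 !mxE /=; ring.
Qed.

Lemma dilat1 : dilat 1 = 1.
Proof. by apply: mx2P; split; rewrite !mxE. Qed.

Lemma dilat_conj v v' k : v' * v = 1 ->
  dilat v' * transl k * dilat v = transl (k * v).
Proof.
move=> v1; apply: mx2P; split;
  rewrite !mxE !big_ord_recl big_ord0 !mxE !big_ord_recl !big_ord0 !mxE /=;
  by ring: v1.
Qed.

Lemma transl_fil pi k : tri_fil pi 1 (transl k - 1).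
Proof.
move=> i j; rewrite !mxE; have [->|ij] := eqVneq i j.
  by rewrite subrr ltnn; split=> // _; exists 0; rewrite mulr0.
split=> [lij|lij]; last by case: eqP lij => [->|]; rewrite ?subr0.
have -> : (1 - (j - i) = 0)%N.
  by have : (i != j :> nat) by []; lia.
by rewrite expr0; eexists; rewrite mul1r.
Qed.

Lemma dilat_fil pi v x : v - 1 = pi * x -> tri_fil pi 1 (dilat v - 1).
Proof.
move=> vx i j; rewrite !mxE; have [->|ij] := eqVneq i j.
  rewrite subnn expr1 ltnn; split=> // _; case: ifP => _; last by exists x.
  by exists 0; rewrite subrr mulr0.
by rewrite subr0; split=> // _; exists 0; rewrite mulr0.
Qed.

(** Modulo the nilpotent element n - m, both m and n are inverses of r + s. *)
Lemma affine_rep (m n r s : int) (d K : nat) :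
  m * r + n * s = 1 -> ((n - m)%:~R : R) ^+ K = 0 ->
  exists rho : BS (d%:Z * m) (d%:Z * n) -> 'M[R]_2,
    [/\ is_rep rho, forall g, tri_fil (n - m)%:~R 1 (rho g - 1) &
        forall k : nat, rho (bs_elt _ _ bs_a ^+ k)%g = 1 -> k%:R = 0 :> R].
Proof.
move=> rs dK; pose dl : R := (n - m)%:~R.
have [w mw] : exists w, m%:~R * w = 1 :> R.
  have [|z mz] := @unit_mod_nilpotent R (dl * s%:~R) (1 - dl * s%:~R) K _ erefl.
    by rewrite exprMn dK mul0r.
  exists ((r + s)%:~R * z); rewrite mulrA -intrM -[RHS]mz; congr (_ * _).
  rewrite /dl -intrM -[X in X - _](mulr1z 1) -intrB; congr (_%:~R).
  by rewrite -rs; ring.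
have [w' nw] : exists w, n%:~R * w = 1 :> R.
  have [|z nz] := @unit_mod_nilpotent R (- dl * r%:~R)
    (1 - - dl * r%:~R) K _ erefl.
    by rewrite exprMn exprNn dK mulr0 mul0r.
  exists ((r + s)%:~R * z); rewrite mulrA -intrM -[RHS]nz; congr (_ * _).
  rewrite /dl mulNr -intrM opprK -[X in _ = X + _](mulr1z 1) -intrD.
  congr (_%:~R).
  by rewrite -rs; ring.
pose v := n%:~R * w; pose v' := m%:~R * w'.
have vv' : v * v' = 1.
  by rewrite /v /v' mulrACA [w * w']mulrC mulrACA nw mw mulr1.
have v'v : v' * v = 1 by rewrite mulrC.
have tpow (k : int) :
    transl (if k < 0 then -1 else 1) ^+ `|k| = transl k%:~R.
  rewrite translX; congr transl; case: k => k; rewrite ?NegzE //=.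
  by rewrite mulrNz mulNrn.
have [||||| rho [rho_rep ra rt ra' rt']] :=
  @bs_rep (d%:Z * m) (d%:Z * n) 'M[R]_2 (transl 1) (transl (-1))
    (dilat v) (dilat v').
- by rewrite translM subrr transl0.
- by rewrite translM addNr transl0.
- by rewrite dilatM vv' dilat1.
- by rewrite dilatM v'v dilat1.
- rewrite -!(fun_if transl) !tpow dilat_conj //; congr transl.
  by rewrite !intrM /v mulrCA mulrA [_ * w]mulrAC; ring: mw.
exists rho; split=> //.
  apply: bs_rep_fil => //; rewrite ?ra ?rt ?ra' ?rt'; try exact: transl_fil.
    apply: (@dilat_fil _ _ w); rewrite /v intrB mulrBl.
    by rewrite mw.
  apply: (@dilat_fil _ _ (- w')); rewrite /v' intrB mulrN mulrBl.
  by rewrite nw opprB.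
move=> k; rewrite (repX rho_rep) ra translX => /matrixP/(_ 0 1).
by rewrite !mxE.
Qed.

End AffineRepresentation.

Local Open Scope group_scope.

(** * Detection of elements of the quotient *)

Section Words.
Variables (G : groupType) (t x b : G) (P : nat).
Hypothesis xP : x ^+ P = b.
Hypothesis xb : forall i : int, commute x (b ^ (t ^z i)).

Let B := conj_closure b t.
Let gen (g : bool) := if g then t else x.

(** A syllable (g, k) is the k-th power of t if g, of x otherwise. *)
Definition word_val (ws : seq (bool * int)) : G :=
  \prod_(w <- ws) gen w.1 ^z w.2.

Definition reduced_syllable (w : bool * int) : bool :=
  if w.1 then (w.2 != 0)%R else ~~ (P %| w.2)%Z.

(** Modulo the normal subgroup B, these are the normal forms of the free product
    of the cyclic groups generated by t and by x, where x has order P. *)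
Definition normal_form y := exists beta ws,
  [/\ B beta, alternating ws, all reduced_syllable ws & y = beta * word_val ws].

Let B_x beta : B beta -> commute x beta.
Proof.
by apply: commute_genr => _ [i ->].
Qed.

Let B_conj g k beta : B beta -> B (beta ^ (gen g ^z k)).
Proof.
case: g => Bb; first exact: conj_closure_conj.
have /commgP := commute_zpow k (commute_sym (B_x Bb)).
by rewrite -conjg_fix => /eqP ->.
Qed.

Let B_bad g k : ~~ reduced_syllable (g, k) -> B (gen g ^z k).
Proof.
case: g; rewrite /reduced_syllable /= negbK.
  by move=> /eqP ->; exact: gen1.
move=> /dvdzP[c ->]; rewrite mulrC zpowM zpow_nat xP.
by apply: gen_zpow; apply: gen_sub; exists 0%R; rewrite conjg1.
Qed.

(** The new syllable is merged with the first one if they carry the same letter;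
    a merged syllable that is not reduced has its value in B. *)
Lemma normal_form_cons g k y : normal_form y -> normal_form (gen g ^z k * y).
Proof.
move=> [beta [ws [Bb alt red ->]]].
have -> : gen g ^z k * (beta * word_val ws) =
    beta ^ (gen g ^z (- k)%R) * (gen g ^z k * word_val ws).
  by rewrite conjgEr zpowN invgK !mulgA mulgVK.
have {Bb}: B (beta ^ (gen g ^z (- k)%R)) by exact: B_conj.
move: (beta ^ _) => {}beta Bb.
have nf j ws' : alternating ((g, j) :: ws') -> all reduced_syllable ws' ->
    normal_form (beta * (gen g ^z j * word_val ws')).
  move=> alt' red'; have [rj|/B_bad Bj] := boolP (reduced_syllable (g, j)).
    exists beta, ((g, j) :: ws'); split=> //; first by rewrite /= rj.
    by rewrite /word_val big_cons.
  exists (beta * gen g ^z j), ws'; split=> //; last by rewrite mulgA.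
    exact: genM.
  exact: path_sorted alt'.
case: ws alt red => [|[h j] ws] alt red; first exact: nf.
have [gh|gh] := eqVneq g h; last by apply: nf => //=; rewrite gh.
rewrite /word_val big_cons /= -gh [gen g ^z k * _]mulgA -zpowD.
apply: nf; last by case/andP: red.
by rewrite gh; case: (ws) alt.
Qed.

Lemma normal_form_gen y :
  gen_subgroup [set z | z = x \/ z = t] y -> normal_form y.
Proof.
apply: gen_ind_l => [|g u nf [->|->]|g u nf [->|->]].
- exists 1, [::]; split=> //; first exact: gen1.
  by rewrite /word_val big_nil mulg1.
- by rewrite -[x]zpow1; exact: (normal_form_cons false).
- by rewrite -[t]zpow1; exact: (normal_form_cons true).
- by rewrite -[x^-1]zpow1 zpowV -zpowN; exact: (normal_form_cons false).
by rewrite -[t^-1]zpow1 zpowV -zpowN; exact: (normal_form_cons true).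
Qed.

End Words.

Section WordDetection.
Variables (G : groupType) (a t : G) (p al c : nat).
Hypothesis p_pr : prime p.
Hypothesis pc : coprime p c.
Let P := (p ^ al)%N.

(** Magnus matrices with a of order p^al and t of order p^e, where p^e exceeds
    all exponents of t in the word. Exponents of a^c are multiplied by c, which
    is prime to p, and reduced modulo p^al; those of t are reduced modulo p^e;
    no syllable becomes trivial. *)
Lemma word_detect (ws : seq (bool * int)) :
  alternating ws -> all (reduced_syllable P) ws -> ws != [::] ->
  exists (e : nat) (N : nat) (A : bool -> 'M['F_p]_N.+1),
    [/\ (A false ^+ P = 1)%R, (A true ^+ (p ^ e) = 1)%R,
        forall g k, tri_fil 0%R 1 (A g ^+ k - 1)%R &
        forall rho : G -> 'M['F_p]_N.+1, is_rep rho -> rho a = A false ->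
          rho t = A true -> rho (word_val t (a ^+ c) ws) <> 1%R].
Proof.
move=> alt red ws0.
pose E := (\sum_(w <- ws) `|w.2|)%N.
pose ex (g : bool) := if g then E else al.
pose red1 (w : bool * int) : bool * nat := (w.1,
  `|((if w.1 then w.2 else (c%:Z * w.2)%R) %% (p ^ ex w.1)%:Z)%Z|%N).
have pex0 g : (0 < p ^ ex g)%N by rewrite expn_gt0 prime_gt0.
have altr : alternating (map red1 ws).
  by rewrite /alternating sorted_map.
have posr : all (fun w => 0 < w.2 < p ^ ex w.1)%N (map red1 ws).
  rewrite all_map; apply/allP => -[g k] wsgk /=.
  have /= rgk := allP red _ wsgk.
  have M0 : ((p ^ ex g)%:Z != 0)%R by rewrite eqz_nat -lt0n.
  set v := (if g then k else _).
  have -> : (`|(v %% (p ^ ex g)%N)%Z| < p ^ ex g)%N.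
    have := ltz_pmod v (pex0 g : (0 < (p ^ ex g)%:Z)%R).
    by have := modz_ge0 v M0; lia.
  rewrite andbT lt0n absz_eq0; apply/negP => /eqP/dvdz_mod0P; rewrite {}/v.
  case: g rgk wsgk {M0} => /=; rewrite /reduced_syllable /= => rk wsk.
    rewrite dvdzE absz_nat => /dvdn_leq; rewrite absz_gt0 rk => /(_ isT).
    have kE : (`|k| <= E)%N.
      by rewrite /E (big_rem _ wsk) /= leq_addr.
    by move=> /leq_trans/(_ kE); rewrite leqNgt ltn_expl // prime_gt1.
  move: rk; rewrite !dvdzE abszM !absz_nat Gauss_dvdr ?coprimeXl //.
  by move=> /negbTE ->.
have wr0 : map red1 ws != [::] by rewrite -size_eq0 size_map size_eq0.
have [N [A [AP Af An1]]] := magnus_detect p_pr altr posr wr0.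
exists E, N, A; split=> //.
move=> rho rho_rep ra rt.
have rz g z k : rho z = A g ->
    rho (z ^z k) = (A g ^+ `|(k %% (p ^ ex g)%:Z)%Z|)%R.
  move=> rzA; rewrite [in LHS](divz_eq k (p ^ ex g)%:Z) zpowD (repM rho_rep).
  rewrite mulrC zpowM zpow_nat (rep_zpow1 rho_rep); last first.
    by rewrite (repX rho_rep) rzA AP.
  rewrite mul1r -{1}[(k %% _)%Z]gez0_abs ?zpow_nat ?(repX rho_rep) ?rzA //.
  by apply: modz_ge0; rewrite eqz_nat -lt0n.
have -> : rho (word_val t (a ^+ c) ws) =
    (\prod_(w <- map red1 ws) A w.1 ^+ w.2)%R; last by apply/eqP.
rewrite /word_val big_map; elim: (ws) => [|[g k] ws' IH].
  by rewrite !big_nil (rep1 rho_rep).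
rewrite !big_cons (repM rho_rep) IH; congr (_ * _)%R; case: g => /=.
  exact: (rz true).
by rewrite -zpow_nat -zpowM (rz false).
Qed.

End WordDetection.

(** For q coming from the intersection of the lower central series, these
    representations are those of the Baumslag-Solitar group: unipotent, with
    the order of a dividing a prime power divisor of d. *)
Definition unipotently_trivial (Q : groupType) (a t : Q) (d : nat) (q : Q) :=
  forall (p al e N : nat) (A : bool -> 'M['F_p]_N.+1), prime p ->
    (p ^ al %| d)%N ->
    (A false ^+ (p ^ al) = 1)%R -> (A true ^+ (p ^ e) = 1)%R ->
    (forall g k, tri_fil 0%R 1 (A g ^+ k - 1)%R) ->
    exists rho : Q -> 'M['F_p]_N.+1,
      [/\ is_rep rho, rho a = A false, rho t = A true & rho q = 1%R].

(** The last condition keeps track of the order of a, which is the additive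
    order of 1 in R: a acts as a translation by 1. *)
Definition affinely_trivial (Q : groupType) (a : Q) (delta : int) (q : Q) :=
  forall (R : comNzRingType) (K : nat), (delta%:~R ^+ K = 0 :> R)%R ->
    exists rho : Q -> 'M[R]_2,
      [/\ is_rep rho, rho q = 1%R &
          forall k : nat, rho (a ^+ k) = 1%R -> (k%:R = 0 :> R)%R].

Lemma conj_closure_pow (G : groupType) (a t : G) (k l : nat) :
  (k %| l)%N -> conj_closure (a ^+ l) t `<=` conj_closure (a ^+ k) t.
Proof.
move=> /dvdnP[c ->]; apply: gen_subset => _ [i ->].
rewrite mulnC expgnA conjXg -(zpow_nat _ c); apply: gen_zpow.
by apply: gen_sub; exists i.
Qed.

Lemma gen_conj_closure (G : groupType) (x t : G) :
  conj_closure x t `<=` gen_subgroup [set z | z = x \/ z = t].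
Proof.
apply: gen_subset => _ [i ->].
have tG : gen_subgroup [set z | z = x \/ z = t] (t ^z i).
  by apply: gen_zpow; apply: gen_sub; right.
rewrite conjgEr; apply: genM => //; apply: genM; first exact: genV.
by apply: gen_sub; left.
Qed.

Lemma rep_conj_closure1 (G : groupType) (R : nzRingType) (rho : G -> R) x t y :
  is_rep rho -> rho x = 1%R -> conj_closure x t y -> rho y = 1%R.
Proof.
move=> rho_rep x1; apply: (rep_gen1 rho_rep) => _ [i ->].
exact: rep_conj1.
Qed.

Section Residual.
Variables (Q : groupType) (a t : Q) (d : nat) (m n r s : int).
Hypothesis d_gt0 : (0 < d)%N.
Let b := a ^+ d.
Hypothesis ab_comm : forall i : int, [~ a, b ^ (t ^z i)] = 1.
Hypothesis coprime_comm : forall e e' (i j : int), (e * e')%N = d ->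
  coprime e e' -> [~ (a ^+ e) ^ (t ^z i), (a ^+ e') ^ (t ^z j)] = 1.

(** As gcd(c, lcm(e, p^k)) divides e, the power a^e is a product of a power of
    a^c and of a power of a^lcm(e, p^k). The latter and its t-conjugates commute
    with a^c by the coprime relators, so they can be collected on the right. *)
Lemma split_prime_part (p c e k : nat) (q : Q) :
  prime p -> coprime p c -> d = (c * p ^ k)%N ->
  gen_subgroup [set z | z = a ^+ e \/ z = t] q ->
  exists y g, [/\ gen_subgroup [set z | z = a ^+ c \/ z = t] y,
    conj_closure (a ^+ lcmn e (p ^ k)) t g & q = y * g].
Proof.
move=> p_pr pc dE; set L := lcmn e _.
have cL : (gcdn c L %| e)%N.
  rewrite -(@Gauss_dvdl _ _ (p ^ k)); last first.
    apply: (coprime_dvdl (dvdn_gcdl c L)).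
    by rewrite coprime_sym coprimeXl.
  apply: dvdn_trans (dvdn_gcdr _ _) _.
  by rewrite dvdn_lcm dvdn_mulr // dvdn_mull.
have [u [v ae]] : exists u v, a ^+ e = (a ^+ c) ^z u * (a ^+ L) ^z v.
  have [u [v uv]] := Bezoutz c L; have /dvdnP[w we] := cL.
  exists (w%:Z * u)%R, (w%:Z * v)%R.
  rewrite -!zpow_nat -!zpowM -zpowD; congr (a ^z _).
  have -> : e = (w%:Z * gcdz c L)%R :> int by rewrite we PoszM /gcdz !absz_nat.
  by rewrite -uv; ring.
have xL g : conj_closure (a ^+ L) t g -> commute (a ^+ c) g.
  apply: commute_genr => _ [i ->].
  have /dvdnP[w ->] : (p ^ k %| L)%N by exact: dvdn_lcmr.
  rewrite mulnC expgnA conjXg; apply: commuteX; apply/commgP.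
  rewrite -[X in [~ X, _]]conjg1 -[X in _ ^ X](zpow0 t).
  by rewrite coprime_comm // coprime_sym coprimeXl.
pose X := gen_subgroup [set z | z = a ^+ c \/ z = t].
pose C := conj_closure (a ^+ L) t.
have Xx z : X ((a ^+ c) ^z z) by apply: gen_zpow; apply: gen_sub; left.
have Xt : X t by apply: gen_sub; right.
have CL z : C ((a ^+ L) ^z z).
  by apply: gen_zpow; apply: gen_sub; exists 0%R; rewrite conjg1.
elim/gen_ind => [|_ z [y [g [Xy Cg ->]]] [->|->]
                 |_ z [y [g [Xy Cg ->]]] [->|->]].
- by exists 1, 1; split; [exact: gen1|exact: gen1|rewrite mulg1].
- exists (y * (a ^+ c) ^z u), (g * (a ^+ L) ^z v).
  split; [exact: genM Xy (Xx u)|exact: genM Cg (CL v)|].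
  rewrite ae !mulgA; congr (_ * _); rewrite -!mulgA; congr (_ * _).
  exact/commute_zpow/commute_sym/xL.
- exists (y * t), (g ^ t); split; [exact: genM|exact: conj_closureJ|].
  by rewrite -!mulgA -conjgC.
- exists (y * (a ^+ c) ^z (- u)%R), (g * (a ^+ L) ^z (- v)%R).
  split; [exact: genM Xy (Xx _)|exact: genM Cg (CL _)|].
  have -> : (a ^+ e)^-1 = (a ^+ c) ^z (- u)%R * (a ^+ L) ^z (- v)%R.
    rewrite ae invgM !zpowN -!invgM; congr _^-1.
    rewrite -!zpow_nat; do 2!rewrite -zpowM; exact: commute_zpow2.
  rewrite !mulgA; congr (_ * _); rewrite -!mulgA; congr (_ * _).
  exact/commute_zpow/commute_sym/xL.
exists (y / t), (g ^ t^-1); split; [exact: gen_div| |].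
  exact: (conj_closure_conj (-1)%R Cg).
by rewrite -!mulgA -conjgC.
Qed.

(** The second factor of q in split_prime_part dies in every representation
    where a has order dividing p^k. Hence the first one dies too, and its normal
    form has to be an element of the closure of b. *)
Lemma unipotent_step (p e : nat) (q : Q) : prime p -> (e %| d)%N ->
  unipotently_trivial a t d q ->
  gen_subgroup [set z | z = a ^+ e \/ z = t] q ->
  conj_closure (a ^+ lcmn e (p ^ logn p d)) t q.
Proof.
move=> p_pr ed qinv qe; have [c pc dE] := pfactor_coprime p_pr d_gt0.
have [y [g [Xy Cg qyg]]] := split_prime_part p_pr pc dE qe.
have Pd : (p ^ logn p d %| d)%N by rewrite [X in (_ %| X)%N]dE dvdn_mull.
have Ld : (lcmn e (p ^ logn p d) %| d)%N by rewrite dvdn_lcm ed.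
have xP : a ^+ c ^+ (p ^ logn p d) = b by rewrite -expgnA -dE.
have xb i : commute (a ^+ c) (b ^ (t ^z i)).
  apply/commute_sym/commuteX/commute_sym; apply/commgP.
  by rewrite ab_comm.
have [beta [ws [Bb alt red yE]]] := normal_form_gen xP xb Xy.
have b_L : conj_closure (a ^+ lcmn e (p ^ logn p d)) t beta.
  exact: conj_closure_pow Ld _ Bb.
have [ws0|ws0] := eqVneq ws [::].
  by rewrite qyg yE ws0 /word_val big_nil mulg1; apply: genM.
have [E [N [A [A0 A1 Af Aw]]]] := word_detect a t p_pr pc alt red ws0.
have [rho [rho_rep ra rt rq]] := qinv p _ E N A p_pr Pd A0 A1 Af.
case: (Aw rho rho_rep ra rt).
have ak k : (p ^ logn p d %| k)%N -> rho (a ^+ k) = 1%R.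
  by move=> /dvdnP[w ->]; rewrite mulnC expgnA !(repX rho_rep) ra A0 expr1n.
have rb : rho beta = 1%R by apply: rep_conj_closure1 Bb => //; exact: ak.
have rg : rho g = 1%R.
  by apply: rep_conj_closure1 Cg => //; apply: ak; exact: dvdn_lcmr.
by move: rq; rewrite qyg yE !(repM rho_rep) rb rg mul1r mulr1.
Qed.

Hypothesis generated : forall q, gen_subgroup [set z | z = a \/ z = t] q.

(** Going through the prime divisors of d one after the other turns e = 1 into
    e = d; a last step, with any prime, removes t. *)
Lemma unipotently_trivialP q :
  unipotently_trivial a t d q -> conj_closure b t q.
Proof.
move=> qinv.
suff H e : (e %| d)%N -> gen_subgroup [set z | z = a ^+ e \/ z = t] q ->
    gen_subgroup [set z | z = a ^+ d \/ z = t] q.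
  have qd := H 1%N (dvd1n _) (generated q).
  have := unipotent_step (isT : prime 2) (dvdnn d) qinv qd.
  by have /lcmn_idPr := pfactor_dvdnn 2 d; rewrite lcmnC => ->.
have [k] := ubnP (d - e)%N; elim: k e => // k IH e dek ed qe.
have [<-|ned] := eqVneq e d; first exact: qe.
have de1 : (1 < d %/ e)%N.
  have := divnK ed; case: (d %/ e)%N => [|[|//]].
    by move=> d0; move: d_gt0; rewrite -d0.
  by rewrite mul1n => /eqP; rewrite (negbTE ned).
have p_pr := pdiv_prime de1; set p := pdiv _ in p_pr.
have Ld : (lcmn e (p ^ logn p d) %| d)%N by rewrite dvdn_lcm ed pfactor_dvdnn.
apply: (IH (lcmn e (p ^ logn p d))) => //; last first.
  exact: gen_conj_closure (unipotent_step p_pr ed qinv qe).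
have e0 : (0 < e)%N by exact: dvdn_gt0 ed.
suff : (e < lcmn e (p ^ logn p d))%N.
  by have := dvdn_leq d_gt0 Ld; have := dvdn_leq d_gt0 ed; lia.
have L0 : (0 < lcmn e (p ^ logn p d))%N.
  by rewrite lcmn_gt0 e0 expn_gt0 prime_gt0.
rewrite ltn_neqAle (dvdn_leq L0 (dvdn_lcml e _)) andbT.
apply/eqP => /esym/lcmn_idPl; rewrite pfactor_dvdn // => le.
have : (p * e %| d)%N.
  by rewrite -(divnK ed) dvdn_mul // pdiv_dvd.
move=> /(dvdn_leq_log p d_gt0); rewrite (lognM p (prime_gt0 p_pr) e0).
have -> : logn p p = 1%N by rewrite logn_prime ?eqxx.
by rewrite add1n ltnNge le.
Qed.

Hypothesis bezout : (m * r + n * s = 1)%R.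
Hypothesis rel : (b ^z m) ^ t = b ^z n.

Let bt_comm : forall i j : int, commute (b ^ (t ^z i)) (b ^ (t ^z j)).
Proof.
apply: (conj_pow_comm bezout rel) => i; rewrite ab_comm => z.
exact/commute_sym/commute1.
Qed.

Let f := root_chain b t r s.

Let window k (e j : int) (l l' : nat) :
  (f k ^z e) ^ (t ^z j) =
  (f (k + l + l')%N ^z (n ^+ l * m ^+ l' * e)%R) ^ (t ^z (j - l%:Z)%R).
Proof.
rewrite mulrAC mulrC !zpowM (root_chain_pow bezout rel bt_comm).
rewrite (root_chain_conj bezout rel bt_comm) -conj_zpow -conjgM.
by rewrite -zpow_nat -zpowD addrC subrK.
Qed.

(** The closure of b is locally cyclic: conjugates of two roots of b are powers
    of a conjugate of one further root. *)
Lemma conj_closure_root q : conj_closure b t q ->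
  exists k (e j : int), q = (f k ^z e) ^ (t ^z j).
Proof.
have mul k1 (e1 j1 : int) k2 (e2 j2 : int) : exists k (e j : int),
    (f k1 ^z e1) ^ (t ^z j1) * (f k2 ^z e2) ^ (t ^z j2) = (f k ^z e) ^ (t ^z j).
  pose N := (`|j1| + `|j2|)%N.
  have [l1 l1E] : exists l : nat, (j1 - l%:Z = - N%:Z)%R.
    by exists `|(j1 + N%:Z)%R|%N; rewrite /N; lia.
  have [l2 l2E] : exists l : nat, (j2 - l%:Z = - N%:Z)%R.
    by exists `|(j2 + N%:Z)%R|%N; rewrite /N; lia.
  rewrite (window k1 e1 j1 l1 (k2 + l2)) (window k2 e2 j2 l2 (k1 + l1)) l1E l2E.
  rewrite [(k2 + l2 + (k1 + l1))%N]addnC -conjMg -zpowD.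
  by exists (k1 + l1 + (k2 + l2))%N; eexists; exists (- N%:Z)%R.
elim/gen_ind => [|_ _ [k [e [j ->]]] [i ->]|_ _ [k [e [j ->]]] [i ->]].
- by exists 0%N, (0%R : int), (0%R : int); rewrite conjg1.
- by have := mul k e j 0%N 1%R i.
have := mul k e j 0%N (-1)%R i; rewrite zpowN zpow1 conjVg; exact.
Qed.

(** If a conjugate of (root_chain k)^e acts trivially, so does its m^k-th power
    b^e, hence d e = 0 in R. It remains to take R = Z/M with M > d |e| and
    n - m nilpotent modulo M, which is possible unless |n - m| = 1. *)
Lemma affinely_trivialP q : (`|n - m|)%R != 1%R -> conj_closure b t q ->
  affinely_trivial a (n - m)%R q -> q = 1.
Proof.
move=> dl1 /conj_closure_root[k [e [j qE]]] qinv.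
suff e0 : e = 0%R by rewrite qE e0 conj1g.
have mod_zero (R : comNzRingType) K : ((n - m)%:~R ^+ K = 0 :> R)%R ->
    ((d * `|e|)%N%:R = 0 :> R)%R.
  move=> /qinv[rho [rho_rep rq rk]]; apply: rk; rewrite expgnA.
  have rf : rho (f k ^z e) = 1%R.
    rewrite -[f k ^z e](conjgK (t ^z j)) -qE.
    exact: rep_conj1.
  have rbe : rho (b ^z e) = 1%R.
    have <- : f k ^z (m ^+ k)%R = b := root_chain_pow bezout rel bt_comm 0 k.
    by rewrite zpowC; apply: rep_zpow1.
  by case: (e) rbe => i //= /(repV1 rho_rep); rewrite invgK.
apply/eqP; apply: contraT => e_neq0.
have D0 : (0 < d * `|e|)%N by rewrite muln_gt0 d_gt0 absz_gt0.
pose D := (d * `|e|)%N.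
have [M [M2 [DM [K dK]]]] : exists M, (1 < M)%N /\ (D < M)%N /\
    exists K, (M %| `|(n - m)%R| ^ K)%N.
  have [dl0|dl0] := eqVneq (n - m)%R 0%R.
    exists D.+2; split=> //; split; first by lia.
    by exists 1%N; rewrite dl0 dvdn0.
  have dl2 : (1 < `|(n - m)%R|)%N by lia.
  exists (`|(n - m)%R| ^ D)%N; split.
    by rewrite -[X in (X < _)%N](expn0 `|(n - m)%R|) ltn_exp2l.
  split; first exact: ltn_expl.
  by exists D.
have := mod_zero 'Z_M K; rewrite -/D.
have Zz : ((n - m)%:~R ^+ K = 0 :> 'Z_M)%R.
  have MK : (M%:R = 0 :> 'Z_M)%R by exact: pchar_Zp.
  rewrite -rmorphXn; move: dK; rewrite -abszX => /dvdnP[c cE].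
  have : (`|((n - m) ^+ K)%R|%:R = 0 :> 'Z_M)%R by rewrite cE natrM MK mulr0.
  case: ((n - m) ^+ K)%R => i /= iM; first exact: iM.
  by rewrite NegzE mulrNz; apply/eqP; rewrite oppr_eq0; apply/eqP.
move=> /(_ Zz) /(congr1 val); rewrite /= val_Zp_nat // modn_small //.
by move=> D00; rewrite -/D D00 in D0.
Qed.

End Residual.

Local Open Scope ring_scope.

(** * The intersection of the lower central series *)

Lemma comm_subgroup_subset (G : groupType) (A B C : set G) :
  A `<=` B -> comm_subgroup A C `<=` comm_subgroup B C.
Proof.
move=> AB; apply: gen_subset => _ [x Ax [y Cy ->]].
by apply: gen_sub; exists x; [exact: AB | exists y].
Qed.

Lemma comm_lcs_omega_sub (G : groupType) :
  comm_subgroup (lcs_omega G) [set: G] `<=` lcs_omega G.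
Proof.
move=> x Wx [|[|c]] //= _.
apply: (comm_subgroup_subset _ Wx) => y Wy.
exact: (Wy c.+1 (ltn0Sn c)).
Qed.

Lemma conj_closure1 (G : groupType) (t x : G) : conj_closure 1%g t x -> x = 1%g.
Proof.
by elim/gen_ind => [//|_ _ -> [i ->]|_ _ -> [i ->]];
  rewrite conj1g ?mulg1 ?divg1.
Qed.

Section ResidualQuotient.
Variables (d : nat) (m n r s : int).
Hypothesis d_gt0 : (0 < d)%N.
Hypothesis bezout : m * r + n * s = 1.

Let G := BS (d%:Z * m) (d%:Z * n).
Let W : set G := lcs_omega G.
Let Q := cquot W.
Let a : G := bs_elt (d%:Z * m) (d%:Z * n) bs_a.
Let t : G := bs_elt (d%:Z * m) (d%:Z * n) bs_t.
Let qa : Q := cproj W a.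
Let qt : Q := cproj W t.

(** A triangular representation of G kills W, hence [W, G], and factors through
    the quotient. *)
Lemma omega_rep (R : comNzRingType) (N K : nat) (pi : R)
    (rho : G -> 'M[R]_N.+1) :
  is_rep rho -> (forall g, tri_fil pi 1 (rho g - 1)) -> pi ^+ K = 0 ->
  exists rho' : Q -> 'M[R]_N.+1,
    [/\ is_rep rho', forall g, rho' (cproj W g) = rho g &
        forall w, W w -> rho w = 1].
Proof.
move=> rho_rep rho_fil piK.
have rhoW w : W w -> rho w = 1 by apply: rep_omega piK.
by have [rho' ? ?] := rep_cquot rho_rep rhoW; exists rho'.
Qed.

Lemma lcs_omega_sub_comm w : W w -> comm_subgroup W [set: G] w.
Proof.
move=> Ww; apply/cproj_eq1.
have rel : ((a ^+ d ^z m) ^ t)%g = (a ^+ d ^z n)%g.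
  have := bs_relation (d%:Z * m) (d%:Z * n).
  by rewrite !zpowM zpow_nat.
have relator x : residual_relator a t d (n - m) x -> cproj W x = 1%g.
  move=> Sx; apply/cproj_eq1.
  exact: (residual_relator_omega d_gt0 bezout rel Sx).
have qrel : ((qa ^+ d ^z m) ^ qt = qa ^+ d ^z n)%g.
  by rewrite -gmulfXn -!gmulf_zpow -rel gmulfJ.
have ab_comm (i : int) : [~ qa, qa ^+ d ^ (qt ^z i)]%g = 1%g.
  rewrite -gmulfXn -gmulf_zpow -gmulfJ -gmulfR.
  by apply: relator; constructor 1; exists i.
have coprime_comm e e' (i j : int) : (e * e')%N = d -> coprime e e' ->
    [~ (qa ^+ e) ^ (qt ^z i), (qa ^+ e') ^ (qt ^z j)]%g = 1%g.
  move=> ee' co; rewrite -!gmulfXn -!gmulf_zpow -!gmulfJ -gmulfR.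
  by apply: relator; constructor 2; exists e, e', i, j.
have gen q : gen_subgroup [set z | z = qa \/ z = qt] q.
  rewrite -[q]creprK.
  elim/gen_ind: (bs_generated (crepr q)) => [|g u IH [->|->]|g u IH [->|->]].
  - by rewrite gmulf1; exact: gen1.
  - by rewrite gmulfM; apply: genM => //; apply: gen_sub; left.
  - by rewrite gmulfM; apply: genM => //; apply: gen_sub; right.
  - by rewrite gmulfF; apply: gen_div => //; apply: gen_sub; left.
  by rewrite gmulfF; apply: gen_div => //; apply: gen_sub; right.
have uni : unipotently_trivial qa qt d (cproj W w).
  move=> p al e N A p_pr pd A0 A1 Af.
  have [|||||rho [rho_rep ra rt rho_fil]] :=
    @unipotent_rep (d%:Z * m) (d%:Z * n)
      _ N 0 A (fun g => p ^ (if g then e else al))%N.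
  - by move=> g; rewrite expn_gt0 prime_gt0.
  - by case.
  - exact: Af.
  - by rewrite abszM dvdn_mulr.
  - by rewrite abszM dvdn_mulr.
  have [rho' [rho'_rep rho'E rhoW]] := omega_rep rho_rep rho_fil (expr1 0).
  by exists rho'; rewrite !rho'E; split=> //; exact: rhoW.
have qB := unipotently_trivialP d_gt0 ab_comm coprime_comm gen uni.
have [dl|dl] := eqVneq `|n - m| 1.
  have b1 : (qa ^+ d = 1)%g.
    by rewrite -gmulfXn; apply: relator; constructor 3.
  by move: qB; rewrite b1; exact: conj_closure1.
apply: (affinely_trivialP d_gt0 ab_comm bezout qrel dl qB) => R K dK.
have [rho [rho_rep rho_fil rk]] := affine_rep d bezout dK.
have [rho' [rho'_rep rho'E rhoW]] := omega_rep rho_rep rho_fil dK.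
exists rho'; split=> //; first by rewrite rho'E; exact: rhoW.
by move=> k; rewrite -gmulfXn rho'E; exact: rk.
Qed.

End ResidualQuotient.

Theorem theorem2 (m n : int) (hm0 : m != 0) (hn0 : n != 0)
  (hm : 0 < m) (hmn : m <= `|n|) :
  let G := BS m n in
  comm_subgroup (lcs_omega G) [set: G] = lcs_omega G.
Proof.
move=> G; apply/seteqP; split; first exact: comm_lcs_omega_sub.
pose d := gcdn `|m| `|n|.
have d_gt0 : (0 < d)%N by rewrite gcdn_gt0 absz_gt0 hm0.
have [r [s rs]] := Bezoutz m n.
have /dvdzP[m' mE] : (d%:Z %| m)%Z by rewrite dvdzE absz_nat dvdn_gcdl.
have /dvdzP[n' nE] : (d%:Z %| n)%Z by rewrite dvdzE absz_nat dvdn_gcdr.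
have bezout : m' * r + n' * s = 1.
  have d0 : d%:Z != 0 by rewrite eqz_nat -lt0n.
  apply: (mulfI d0); rewrite mulr1 -[RHS]/(gcdz m n) -rs {1}mE {1}nE; ring.
rewrite {}/G; move: d d_gt0 mE nE => d d_gt0.
rewrite ![_ * d%:Z]mulrC => -> ->.
exact: lcs_omega_sub_comm d_gt0 bezout.
Qed.
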